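(* Let $\mathfrak{P}$ be any family of distributions, and let $\alpha,\beta,\varepsilon>0$ be sufficiently small. If there exists a $0.1\alpha$-cover of $\mathfrak{P}$ under the TV distance of size $L$, then \[ n_m^{\mathrm{dlearn}(\mathfrak{P};\alpha)}(\varepsilon,\delta=0)\le\tilde{O}\left(\frac{L}{\varepsilon}+\frac{L}{\alpha\varepsilon\sqrt{m}}+\frac{L}{\alpha^2 m}\right). \] Furthermore, if there exists a family $\mathfrak{Q}$ of size $L$ that is a $3\alpha$-packing of $\mathfrak{P}$ under the TV distance and has diameter at most $\beta$ under the KL-divergence, then \[ n_m^{\mathrm{dlearn}(\mathfrak{P};\alpha)}(\varepsilon,\delta=0)\ge\tilde{\Omega}\left(\frac{L}{\varepsilon}+\frac{L}{\varepsilon\sqrt{m\beta}}+\frac{L}{m\beta}\right). \]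
   Context: User-level DP: there are $n$ users each holding $m$ examples from $\mathcal{Z}$; two inputs in $\mathcal{Z}^{nm}$ are user-level neighbors if they differ only in one user's $m$ examples; an algorithm is $(\varepsilon,\delta)$-user-level DP if $\Pr[\mathbf{A}(\mathbf{x})\in S]\le e^\varepsilon\Pr[\mathbf{A}(\mathbf{x}')\in S]+\delta$ for all neighbors and all output sets $S$. For a task with correct-answer sets $\Psi(\mathcal{D})$, $n_m(\varepsilon,\delta)$ is the smallest $n$ such that some $(\varepsilon,\delta)$-user-level DP algorithm, given $nm$ i.i.d. samples from $\mathcal{D}$ grouped into $n$ users, outputs an element of $\Psi(\mathcal{D})$ with probability at least $2/3$ for every valid $\mathcal{D}$. In $\mathrm{dlearn}(\mathfrak{P};\alpha)$ the valid distributions are those in $\mathfrak{P}$ and a correct output is a distribution $\mathcal{Q}$ with $d_{\mathrm{TV}}(\mathcal{Q},\mathcal{D})\le\alpha$. A family $\mathfrak{Q}$ is an $\alpha$-cover of $\mathfrak{P}$ under distance $d$ if every $\mathcal{P}\in\mathfrak{P}$ has some $\mathcal{Q}\in\mathfrak{Q}$ with $d(\mathcal{Q},\mathcal{P})\le\alpha$; it is an $\alpha$-packing of $\mathfrak{P}$ under $d$ if $\mathfrak{Q}\subseteq\mathfrak{P}$ and $d(\mathcal{Q},\mathcal{Q}')\ge\alpha$ for all distinct $\mathcal{Q},\mathcal{Q}'\in\mathfrak{Q}$. The size of $\mathfrak{Q}$ is $\log|\mathfrak{Q}|$, and its diameter under $d$ is $\max_{\mathcal{Q},\mathcal{Q}'\in\mathfrak{Q}}d(\mathcal{Q},\mathcal{Q}')$.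 $\tilde{O},\tilde{\Omega}$ hide polylogarithmic factors. *)

(* Defs.v *)
From HB Require Import structures.
From mathcomp Require Import all_boot all_order all_algebra.
From mathcomp Require Import all_classical all_reals all_analysis.

Set Implicit Arguments.
Unset Strict Implicit.
Unset Printing Implicit Defensive.

Import Order.TTheory GRing.Theory Num.Theory.
Import numFieldNormedType.Exports.

Local Open Scope classical_set_scope.
Local Open Scope ring_scope.

Section distances.
Context (d : measure_display) (Z : measurableType d) (R : realType).
Implicit Types P Q : probability Z R.
Local Open Scope ereal_scope.

Definition dTV P Q : \bar R :=
  ereal_sup [set `|P A - Q A| | A in [set A : set Z | measurable A]].

(* The value of the density outside a P-null set is immaterial, and the
   negative part of the integrand is always P-integrable, so the integral never
   takes the form oo - oo. *)
Definition dKL P Q : \bar R :=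
  if `[< P `<< Q >]
  then \int[P]_x
         (ln (fine (Radon_Nikodym (charge_of_finite_measure P) Q x)))%:E
  else +oo.

End distances.

Section families.
Context (T : Type) (R : realType) (dist : T -> T -> \bar R).
Local Open Scope ereal_scope.

Definition is_cover (a : R) (PP QQ : set T) :=
  forall P, PP P -> exists2 Q, QQ Q & dist Q P <= a%:E.

Definition is_packing (a : R) (PP QQ : set T) :=
  QQ `<=` PP /\
  forall Q Q', QQ Q -> QQ Q' -> Q <> Q' -> a%:E <= dist Q Q'.

Definition diameter (QQ : set T) : \bar R :=
  ereal_sup [set dist Q Q' | Q in QQ & Q' in QQ].

End families.

Definition has_size (R : realType) (T : Type) (QQ : set T) (L : R) :=
  exists N : nat, [/\ (0 < N)%N, (QQ #= `I_N)%card & L = ln N%:R].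

Section iid.
Context (d : measure_display) (Z : measurableType d) (R : realType).

Definition cons_pair n (p : Z * n.-tuple Z) : n.+1.-tuple Z :=
  [tuple of p.1 :: p.2].

Lemma measurable_cons_pair n : measurable_fun [set: Z * n.-tuple Z]
  (@cons_pair n).
Proof. exact: measurable_cons. Qed.

HB.instance Definition _ n := isMeasurableFun.Build _ _ _ _
  (@cons_pair n) (@measurable_cons_pair n).

Fixpoint iid (D : probability Z R) (n : nat) : probability (n.-tuple Z) R :=
  match n with
  | 0 => dirac [tuple]
  | n'.+1 => distribution (D \x iid D n')%E (@cons_pair n')
  end.

End iid.

Record task (d d' : measure_display) (Z : measurableType d)
    (O : measurableType d') (R : realType) := Task {
  valid : set (probability Z R) ;
  correct : probability Z R -> set O }.

(* A dataset of n users holding m examples each is an n.-tuple (m.-tuple Z);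
   a randomized algorithm is a probability kernel from datasets to outputs. *)
Section user_level.
Context (d d' : measure_display) (Z : measurableType d)
  (O : measurableType d') (R : realType).
Local Open Scope ereal_scope.

Definition user_neighbors n m (x x' : n.-tuple (m.-tuple Z)) :=
  exists i : 'I_n, forall j : 'I_n, j != i -> tnth x j = tnth x' j.

Definition user_level_DP n m (eps delta : R)
    (A : R.-pker (n.-tuple (m.-tuple Z)) ~> O) :=
  forall x x', user_neighbors x x' -> forall S : set O, measurable S ->
    A x S <= (expR eps)%:E * A x' S + delta%:E.

Definition solves n m (t : task Z O R)
    (A : R.-pker (n.-tuple (m.-tuple Z)) ~> O) :=
  forall D, valid t D ->
    (2 / 3)%:E <= \int[iid (iid D m) n]_x A x (correct t D).

(* The least such number of users, and +oo if there is none. *)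
Definition user_complexity (m : nat) (t : task Z O R) (eps delta : R)
    : \bar R :=
  ereal_inf [set n%:R%:E | n in [set n : nat |
    exists A : R.-pker (n.-tuple (m.-tuple Z)) ~> O,
      user_level_DP eps delta A /\ solves t A]].

End user_level.

Section dlearn.
Context (d : measure_display) (Z : measurableType d) (R : realType).

Definition TV_ball (D : probability Z R) (a : R) : set (probability Z R) :=
  [set Q | (dTV Q D <= a%:E)%E].

Definition TV_balls : set (set (probability Z R)) :=
  [set B | exists D a, B = TV_ball D a].

(* The sigma-algebra generated by the closed TV balls, i.e. by the sets of
   correct answers; the one of pprobability need not contain these balls when
   that of Z is not countably generated. *)
Definition learned : measurableType TV_balls.-sigma :=
  g_sigma_algebraType TV_balls.

Definition dlearn (PP : set (probability Z R)) (alpha : R)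
    : task Z learned R :=
  Task (O := learned) PP (fun D => TV_ball D alpha).

End dlearn.

(* f = O~(g) is read as f = O(g * log^k g), and f = Omega~(g) as
   f = Omega(g / log^k g), for some k; the shifts keep the factor at least 1
   for all g >= 0. *)
Definition polylog (R : realType) (k : nat) (g : R) : R :=
  (1 + ln (1 + g)) ^+ k.

(* Main.v *)
(* Lower bound. In its Donsker-Varadhan form, [E_P h <= b + ln E_Q e^h] for all
   bounded h, a bound b on the KL divergence passes from one sample to m samples
   and from one user to n users by integrating out one coordinate at a time.
   Some hypothesis Q_j of the packing is output with probability at most
   1 / (3 (N - 1)) under another one, Q_0, and at least 2 / 3 under itself. For
   nm samples the variational bound with e^h = 1 + (N - 1) Pr[output near Q_j]
   gives L <= 6 n m beta. For m samples it gives Pinsker's inequality; an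
   eps-DP acceptance probability varies by a factor at most e^eps with each
   user, so replacing the data of one user multiplies its mean by at most
   1 + 3 eps min (1, 3 sqrt (m beta)), whence
   L <= 3 eps n min (1, 3 sqrt (m beta)).

   Upper bound. Run the exponential mechanism on the cover, the score of Q_i
   being the maximum, over the sets W separating two members of the cover, of
   the absolute value of the sum over users of the deviation of the user's
   empirical frequency of W from Q_i(W), clipped to [-B, B] and divided by B.
   One user moves a score by at most 2. With B of order alpha + 1 / sqrt m up to
   a logarithm, clipping biases the mean by at most alpha / 10, so the scores of
   good and bad hypotheses differ by n alpha / (10 B) as soon as all the
   averages over users concentrate, which a union bound over the N^3 statistics
   ensures once n (alpha / B)^2 is of order L. *)
From HB Require Import structures.
Require Import Defs.
From mathcomp Require Import all_boot all_order all_algebra.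
From mathcomp Require Import all_classical all_reals all_analysis.
From mathcomp Require Import measurable_realfun.
From mathcomp Require Import ring lra.

Set Implicit Arguments.
Unset Strict Implicit.
Unset Printing Implicit Defensive.
Import Order.TTheory GRing.Theory Num.Theory.
Import numFieldNormedType.Exports.

Local Open Scope classical_set_scope.
Local Open Scope ring_scope.

(** * Means of bounded measurable functions *)

Section bounded_measurable.
Context {d : measure_display} {T : measurableType d} {R : realType}.
Implicit Types (P : probability T R) (f g h : T -> R).

(** Such functions are integrable against every probability measure and closed under the operations
    used below, so their means are real numbers, linear and monotone without integrability side
    conditions. *)
Definition bmeas f :=
  measurable_fun [set: T] f /\ exists M, forall x, `|f x| <= M.

Definition mean P f : R := \int[P]_x f x.

Lemma bmeas_cst (c : R) : bmeas (fun=> c).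
Proof. by split; [exact: measurable_cst | exists `|c|]. Qed.

Lemma bmeasD f g : bmeas f -> bmeas g -> bmeas (fun x => f x + g x).
Proof.
move=> [mf [M fM]] [mg [N gN]]; split; first exact: measurable_funD.
by exists (M + N) => x; rewrite (le_trans (ler_normD _ _))// lerD.
Qed.

Lemma bmeasN f : bmeas f -> bmeas (fun x => - f x).
Proof.
move=> [mf [M fM]]; split; first exact: measurable_funN.
by exists M => x; rewrite normrN.
Qed.

Lemma bmeasB f g : bmeas f -> bmeas g -> bmeas (fun x => f x - g x).
Proof. by move=> bf bg; apply: bmeasD => //; exact: bmeasN. Qed.

Lemma bmeasM f g : bmeas f -> bmeas g -> bmeas (fun x => f x * g x).
Proof.
move=> [mf [M fM]] [mg [N gN]]; split; first exact: measurable_funM.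
by exists (M * N) => x; rewrite normrM ler_pM.
Qed.

Lemma bmeasZ (c : R) f : bmeas f -> bmeas (fun x => c * f x).
Proof. by move=> bf; apply: bmeasM => //; exact: bmeas_cst. Qed.

Lemma bmeas_norm f : bmeas f -> bmeas (fun x => `|f x|).
Proof.
move=> [mf [M fM]]; split; first exact: (measurableT_comp (@normr_measurable R setT)).
by exists M => x; rewrite normr_id.
Qed.

Lemma bmeas_max f g : bmeas f -> bmeas g -> bmeas (fun x => Num.max (f x) (g x)).
Proof.
move=> [mf [M fM]] [mg [N gN]]; split; first exact: measurable_maxr.
exists (Num.max M N) => x; rewrite le_max.
by case: (leP (f x) (g x)) => _; rewrite ?fM ?gN ?orbT.
Qed.

Lemma bmeas_min f g : bmeas f -> bmeas g -> bmeas (fun x => Num.min (f x) (g x)).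
Proof.
move=> [mf [M fM]] [mg [N gN]]; split; first exact: measurable_minr.
exists (Num.max M N) => x; rewrite le_max.
by case: (leP (f x) (g x)) => _; rewrite ?fM ?gN ?orbT.
Qed.

Lemma bmeas_expR f : bmeas f -> bmeas (fun x => expR (f x)).
Proof.
move=> [mf [M fM]]; split; first exact: (measurableT_comp (@measurable_expR R)).
exists (expR M) => x; rewrite ger0_norm ?expR_ge0// ler_expR.
exact: le_trans (ler_norm _) (fM x).
Qed.

Lemma bmeas_ln (a : R) f : 0 < a -> (forall x, a <= f x) -> bmeas f ->
  bmeas (fun x => ln (f x)).
Proof.
move=> a0 af [mf [M fM]]; split; first exact: (measurableT_comp (@measurable_ln R)).
exists (Num.max `|ln a| `|ln M|) => x.
have fx0 : 0 < f x by exact: lt_le_trans a0 (af x).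
have fxM : f x <= M by exact: le_trans (ler_norm _) (fM x).
have h1 : ln a <= ln (f x) by rewrite ler_ln.
have h2 : ln (f x) <= ln M by rewrite ler_ln// posrE (lt_le_trans fx0).
rewrite le_max; have [h|h] := leP 0 (ln (f x)).
  by rewrite (ger0_norm h) (ger0_norm (le_trans h h2)) h2 orbT.
rewrite (ltr0_norm h) ler0_norm; last exact: le_trans h1 (ltW h).
by rewrite lerN2 h1.
Qed.

Lemma bmeasV (a : R) f : 0 < a -> (forall x, a <= f x) -> bmeas f ->
  bmeas (fun x => (f x)^-1).
Proof.
move=> a0 af bf.
rewrite (_ : (fun x => (f x)^-1) = fun x => expR (- ln (f x))); last first.
  apply/funext => x; rewrite expRN lnK// posrE.
  exact: lt_le_trans a0 (af x).
by apply: bmeas_expR; apply: bmeasN; exact: bmeas_ln af bf.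
Qed.

Lemma bmeas_indic (A : set T) : measurable A -> bmeas (\1_A).
Proof.
move=> mA; split; first exact: measurable_indic.
by exists 1 => x; rewrite indicE; case: (_ \in _); rewrite ?normr1 ?normr0.
Qed.

Lemma bmeas_sum (I : Type) (r : seq I) (p : pred I) (f : I -> T -> R) :
  (forall i, bmeas (f i)) -> bmeas (fun x => \sum_(i <- r | p i) f i x).
Proof.
move=> bf; elim: r => [|i r IH].
  rewrite (_ : (fun _ => _) = fun=> 0); first exact: bmeas_cst.
  by apply/funext => x; rewrite big_nil.
case pi : (p i); last first.
  rewrite (_ : (fun _ => _) = fun x => \sum_(j <- r | p j) f j x)//.
  by apply/funext => x; rewrite big_cons pi.
rewrite (_ : (fun _ => _) = fun x => f i x + \sum_(j <- r | p j) f j x).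
  exact: bmeasD.
by apply/funext => x; rewrite big_cons pi.
Qed.

Lemma bmeas_prod (I : Type) (r : seq I) (f : I -> T -> R) :
  (forall i, bmeas (f i)) -> bmeas (fun x => \prod_(i <- r) f i x).
Proof.
move=> bf; elim: r => [|i r IH].
  rewrite (_ : (fun _ => _) = fun=> 1); first exact: bmeas_cst.
  by apply/funext => x; rewrite big_nil.
rewrite (_ : (fun _ => _) = fun x => f i x * \prod_(j <- r) f j x).
  exact: bmeasM.
by apply/funext => x; rewrite big_cons.
Qed.

Lemma bmeas_bigmax (I : Type) (r : seq I) (f : I -> T -> R) :
  (forall i, bmeas (f i)) -> bmeas (fun x => \big[Num.max/0]_(i <- r) f i x).
Proof.
move=> bf; elim: r => [|i r IH].
  rewrite (_ : (fun _ => _) = fun=> 0); first exact: bmeas_cst.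
  by apply/funext => x; rewrite big_nil.
rewrite (_ : (fun _ => _) = fun x => Num.max (f i x) (\big[Num.max/0]_(j <- r) f j x)).
  exact: bmeas_max.
by apply/funext => x; rewrite big_cons.
Qed.

Lemma bmeas_integrable P f : bmeas f -> P.-integrable [set: T] (EFin \o f).
Proof.
move=> [mf [M fM]]; apply: measurable_bounded_integrable => //.
  by apply: (@le_lt_trans _ _ 1%E); [exact: probability_le1|rewrite ltry].
exists M; split; first exact: num_real.
by move=> y My x _ /=; apply: le_trans (fM x) (ltW My).
Qed.

Lemma meanE P f : bmeas f -> (mean P f)%:E = (\int[P]_x (f x)%:E)%E.
Proof.
move=> bf; rewrite /mean /Rintegral fineK//.
exact: integrable_fin_num (bmeas_integrable P bf).
Qed.

Lemma mean_cst P (c : R) : mean P (fun=> c) = c.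
Proof. by rewrite /mean Rintegral_cst//= probability_setT mulr1. Qed.

Lemma meanD P f g : bmeas f -> bmeas g ->
  mean P (fun x => f x + g x) = mean P f + mean P g.
Proof. by move=> bf bg; rewrite /mean RintegralD//; exact: bmeas_integrable. Qed.

Lemma meanB P f g : bmeas f -> bmeas g ->
  mean P (fun x => f x - g x) = mean P f - mean P g.
Proof. by move=> bf bg; rewrite /mean RintegralB//; exact: bmeas_integrable. Qed.

Lemma meanZ P (c : R) f : bmeas f -> mean P (fun x => c * f x) = c * mean P f.
Proof. by move=> bf; rewrite /mean RintegralZl//; exact: bmeas_integrable. Qed.

Lemma le_mean P f g : bmeas f -> bmeas g -> (forall x, f x <= g x) ->
  mean P f <= mean P g.
Proof. by move=> bf bg fg; apply: le_Rintegral => //; exact: bmeas_integrable. Qed.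

Lemma mean_ge P (c : R) f : bmeas f -> (forall x, c <= f x) -> c <= mean P f.
Proof.
by move=> bf cf; rewrite -(mean_cst P c); apply: le_mean => //; exact: bmeas_cst.
Qed.

Lemma mean_le P (c : R) f : bmeas f -> (forall x, f x <= c) -> mean P f <= c.
Proof.
by move=> bf cf; rewrite -(mean_cst P c); apply: le_mean => //; exact: bmeas_cst.
Qed.

Lemma mean_sum P (I : Type) (r : seq I) (p : pred I) (f : I -> T -> R) :
  (forall i, bmeas (f i)) ->
  mean P (fun x => \sum_(i <- r | p i) f i x) = \sum_(i <- r | p i) mean P (f i).
Proof.
move=> bf; elim: r => [|i r IH].
  rewrite big_nil (_ : (fun _ => _) = fun=> 0) ?mean_cst//.
  by apply/funext => x; rewrite big_nil.
rewrite big_cons -IH; case pi : (p i); last first.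
  by congr mean; apply/funext => x; rewrite big_cons pi.
rewrite -meanD//; last exact: bmeas_sum.
by congr mean; apply/funext => x; rewrite big_cons pi.
Qed.

Lemma mean_indic P (A : set T) : measurable A -> (mean P (\1_A))%:E = P A.
Proof. by move=> mA; rewrite meanE ?integral_indic ?setIT//; exact: bmeas_indic. Qed.

End bounded_measurable.

Lemma bmeas_comp d d' (T : measurableType d) (T' : measurableType d')
    (R : realType) (f : T' -> R) (g : T -> T') :
  measurable_fun setT g -> bmeas f -> bmeas (fun x => f (g x)).
Proof.
move=> mg [mf [M fM]]; split; first exact: measurableT_comp mf mg.
by exists M => x.
Qed.

(** * Means under i.i.d. samples *)

Section iid_mean.
Context {d : measure_display} {T : measurableType d} {R : realType}.
Implicit Types (P : probability T R).

Lemma measurable_cons_pair2 n (z : T) :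
  measurable_fun setT (fun t : n.-tuple T => cons_pair (z, t)).
Proof.
apply: (@measurableT_comp _ _ _ _ _ _ (@cons_pair _ T n)).
  exact: measurable_cons_pair.
exact: pair1_measurable.
Qed.

Lemma bmeas_section n (z : T) (H : n.+1.-tuple T -> R) : bmeas H ->
  bmeas (fun t => H (cons_pair (z, t))).
Proof. by apply: bmeas_comp; exact: measurable_cons_pair2. Qed.

Let bmeas_pair n (H : n.+1.-tuple T -> R) : bmeas H ->
  bmeas (fun p : T * n.-tuple T => H (cons_pair p)).
Proof. by apply: bmeas_comp; exact: measurable_cons_pair. Qed.

Lemma bmeas_inner P n (H : n.+1.-tuple T -> R) : bmeas H ->
  bmeas (fun z => mean (iid P n) (fun t => H (cons_pair (z, t)))).
Proof.
move=> bH; have bp := bmeas_pair bH; split; last first.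
  have [_ [M HM]] := bH; exists M => z; rewrite ler_norml; apply/andP; split.
    by apply: mean_ge => [|t]; [exact: bmeas_section|exact: lerNnormlW].
  by apply: mean_le => [|t]; [exact: bmeas_section|exact: ler_normlW].
apply/measurable_EFinP.
rewrite (_ : _ \o _ = fubini_F (iid P n) (fun p => (H (cons_pair p))%:E)).
  apply: (@measurable_fubini_F _ _ _ _ _ P (iid P n)).
  exact: (bmeas_integrable (P \x iid P n)%E bp).
by apply/funext => z /=; rewrite meanE//; exact: bmeas_section.
Qed.

(** Change of variables along [cons_pair], then Fubini. This recursion drives every induction on the
    number of samples below. *)
Lemma mean_iidS P n (H : n.+1.-tuple T -> R) : bmeas H ->
  mean (iid P n.+1) H =
  mean P (fun z => mean (iid P n) (fun t => H (cons_pair (z, t)))).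
Proof.
move=> bH; have bp := bmeas_pair bH; apply: EFin_inj.
rewrite meanE// meanE; last exact: bmeas_inner.
rewrite [LHS](@integral_distribution _ _ _ _ _ (P \x iid P n)%E (@cons_pair _ T n)
  (EFin \o H)); last 2 first.
  - by apply/measurable_EFinP; case: bH.
  - exact: (bmeas_integrable (P \x iid P n)%E bp).
rewrite -(@integral12_prod_meas1 _ _ _ _ _ P (iid P n)); last first.
  exact: (bmeas_integrable (P \x iid P n)%E bp).
by apply: eq_integral => z _; rewrite /= meanE//; exact: bmeas_section.
Qed.

Lemma mean_iid0 P (H : 0.-tuple T -> R) : mean (iid P 0) H = H [tuple].
Proof.
rewrite (_ : H = fun=> H [tuple]) ?mean_cst//.
by apply/funext => x; rewrite tuple0.
Qed.

Lemma bmeas_tnth n (i : 'I_n) (f : T -> R) : bmeas f ->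
  bmeas (fun x : n.-tuple T => f (tnth x i)).
Proof. by apply: bmeas_comp; exact: measurable_tnth. Qed.

Lemma mean_iid_prod P n (f : T -> R) : bmeas f ->
  mean (iid P n) (fun x => \prod_i f (tnth x i)) = mean P f ^+ n.
Proof.
move=> bf; elim: n => [|n IH]; first by rewrite mean_iid0 big_ord0.
rewrite mean_iidS; last by apply: bmeas_prod => i; exact: bmeas_tnth.
have bprod : bmeas (fun t : n.-tuple T => \prod_i f (tnth t i)).
  by apply: bmeas_prod => i; exact: bmeas_tnth.
rewrite (_ : (fun z => _) = fun z => mean P f ^+ n * f z).
  by rewrite meanZ// exprSr.
apply/funext => z; rewrite -IH mulrC -meanZ//; congr mean.
apply/funext => t; rewrite big_ord_recl tnth0; congr (_ * _).
by apply: eq_bigr => i _; rewrite tnthS.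
Qed.

Lemma mean_iid_tnth P n (i : 'I_n) (f : T -> R) : bmeas f ->
  mean (iid P n) (fun x => f (tnth x i)) = mean P f.
Proof.
move=> bf; elim: n i => [[]//|n IH] i.
rewrite mean_iidS; last exact: bmeas_tnth.
have [->|[j ->]] : i = ord0 \/ exists j, i = lift ord0 j.
  by case: (unliftP ord0 i) => [j ->|->]; [right; exists j|left].
  by congr mean; apply/funext => z; rewrite -[RHS](mean_cst (iid P n)); congr mean;
    apply/funext => t; rewrite tnth0.
rewrite -(IH j) -[RHS](mean_cst P); congr mean; apply/funext => z; congr mean.
by apply/funext => t; rewrite tnthS.
Qed.

End iid_mean.

(** * Moment generating functions of bounded centred variables *)

Section mgf.
Context {d : measure_display} {T : measurableType d} {R : realType}.
Implicit Types (P : probability T R).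

(** From 1 - x <= e^-x one gets e^x <= 1 / (1 - x), and (1 - x) (1 + x + 2 x^2) = 1 + x^2 (1 - 2 x)
    >= 1. *)
Lemma expR_le1DxD2x2 (x : R) : `|x| <= 1 / 2 -> expR x <= 1 + x + 2 * x ^+ 2.
Proof.
rewrite ler_norml => /andP[x1 x2].
have x10 : 0 < 1 - x by lra.
have : expR x <= (1 - x)^-1.
  rewrite -[leLHS]invrK -expRN lef_pV2 ?posrE ?expR_gt0//.
  exact: expR_ge1Dx.
move/le_trans; apply; rewrite -[leLHS]mul1r ler_pdivrMr//; nra.
Qed.

(** A crude Hoeffding lemma: the linear term of the quadratic bound on exp has mean 0, and 1 + y <=
    e^y absorbs the rest. *)
Lemma mgf_le P (f : T -> R) (l c : R) : bmeas f -> 0 <= c ->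
  (forall x, `|f x| <= c) -> mean P f = 0 -> `|l| * c <= 1 / 2 ->
  mean P (fun x => expR (l * f x)) <= expR (2 * (l * c) ^+ 2).
Proof.
move=> bf c0 fc f0 lc.
have fl x : `|l * f x| <= `|l| * c by rewrite normrM ler_wpM2l.
have : mean P (fun x => expR (l * f x)) <=
    mean P (fun x => (1 + 2 * (l * c) ^+ 2) + l * f x).
  apply: le_mean => [||x].
  - by apply: bmeas_expR; exact: bmeasZ.
  - by apply: bmeasD; [exact: bmeas_cst|exact: bmeasZ].
  have := expR_le1DxD2x2 (le_trans (fl x) lc).
  have : (l * f x) ^+ 2 <= (l * c) ^+ 2.
    rewrite -[leLHS]real_normK ?num_real// -[leRHS]real_normK ?num_real//.
    by rewrite ler_sqr ?nnegrE// [leRHS]normrM (ger0_norm c0).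
  lra.
rewrite meanD; [|exact: bmeas_cst|exact: bmeasZ].
rewrite mean_cst meanZ// f0 mulr0 addr0 => /le_trans; apply.
exact: expR_ge1Dx.
Qed.

Lemma mgf_iid_le P n (f : T -> R) (l c : R) : bmeas f -> 0 <= c ->
  (forall x, `|f x| <= c) -> mean P f = 0 -> `|l| * c <= 1 / 2 ->
  mean (iid P n) (fun x => expR (l * \sum_i f (tnth x i))) <=
  expR (n%:R * (2 * (l * c) ^+ 2)).
Proof.
move=> bf c0 fc f0 lc; rewrite expRM_natl.
rewrite (_ : (fun x => _) = fun x : n.-tuple T => \prod_i expR (l * f (tnth x i))).
  have be : bmeas (fun z => expR (l * f z)) by apply: bmeas_expR; exact: bmeasZ.
  rewrite (@mean_iid_prod _ _ _ P n (fun z => expR (l * f z)))//.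
  rewrite lerXn2r ?nnegrE ?expR_ge0//; first by apply: mean_ge => // x; exact: expR_ge0.
  exact: mgf_le.
by apply/funext => x; rewrite mulr_sumr expR_sum.
Qed.

End mgf.

(** * Lower bound *)

Section donsker_varadhan.
Context {d : measure_display} {T : measurableType d} {R : realType}.
Implicit Types (P Q : probability T R).

Definition DV_bound P Q (b : R) := forall h : T -> R, bmeas h ->
  mean P h <= b + ln (mean Q (fun x => expR (h x))).

Lemma mean_expR_gt0 P (h : T -> R) : bmeas h ->
  0 < mean P (fun x => expR (h x)).
Proof.
move=> bh; have [_ [M hM]] := bh; apply: lt_le_trans (expR_gt0 (- M)) _.
apply: mean_ge; first exact: bmeas_expR.
by move=> x; rewrite ler_expR; exact: lerNnormlW.
Qed.

(** With r the density of P and c = ln E_Q e^h, a change of measure gives E_P e^(h - c - ln r) <=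
    E_Q e^(h - c) = 1; the tangent inequality of exp then leaves E_P h - c <= E_P ln r. *)
Lemma DV_density P Q (r : T -> R) (b : R) :
  measurable_fun setT r -> (forall x, 0 <= r x) ->
  (forall g : T -> \bar R, (forall x, 0 <= g x)%E -> measurable_fun setT g ->
    (\int[Q]_x (g x * (r x)%:E) = \int[P]_x g x)%E) ->
  (\int[P]_x (ln (r x))%:E <= b%:E)%E -> DV_bound P Q b.
Proof.
move=> mr r0 cov Lb h bh; have [mh _] := bh.
(* As ln 0 = 0, the inequality 1 + y <= e^y with y = h - c - u below holds
   everywhere, including where the density r vanishes. *)
set u := fun x => ln (r x).
have mu : measurable_fun setT u by exact: (measurableT_comp (@measurable_ln R)).
(* Only an inequality: where r = 0, the integrand e^(k - u) r vanishes while e^k does not. *)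
have int_exp (k : T -> R) : bmeas k ->
    (\int[P]_x (expR (k x - u x))%:E <= (mean Q (fun x => expR (k x)))%:E)%E.
  move=> bk; have [mk _] := bk; rewrite -cov; last 2 first.
  - by move=> x; rewrite lee_fin expR_ge0.
  - apply/measurable_EFinP/(measurableT_comp (@measurable_expR R)).
    exact: measurable_funB.
  rewrite meanE; last exact: bmeas_expR.
  apply: ge0_le_integral => //.
  - by move=> x _; rewrite -EFinM lee_fin mulr_ge0 ?expR_ge0.
  - apply/measurable_EFinP/measurable_funM => //.
    apply: (measurableT_comp (@measurable_expR R)); exact: measurable_funB.
  - by apply/measurable_EFinP/(measurableT_comp (@measurable_expR R)).
  move=> x _; rewrite -EFinM lee_fin expRD /u.
  have [->|rx0] := eqVneq (r x) 0; first by rewrite mulr0 expR_ge0.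
  have {rx0} rx0 : 0 < r x by rewrite lt_neqAle eq_sym rx0 r0.
  by rewrite expRN lnK// -mulrA mulVf ?gt_eqF// mulr1.
(* The negative part of u is at most e^-u, whose mean under P is at most 1 by [int_exp] with k =
   0. *)
have iu_neg : (\int[P]_x ((fun x => (u x)%:E)^\- x) < +oo)%E.
  apply: (@le_lt_trans _ _ (\int[P]_x (expR (0 - u x))%:E)%E).
    apply: ge0_le_integral => //.
    - exact/measurable_funeneg/measurable_EFinP.
    - apply/measurable_EFinP/(measurableT_comp (@measurable_expR R)).
      exact: measurable_funB.
    move=> x _; rewrite funenegE -EFinN -EFin_max lee_fin ge_max expR_ge0 andbT.
    have := expR_ge1Dx (0 - u x); lra.
  by apply: le_lt_trans (int_exp (fun=> 0) (bmeas_cst _)) _; rewrite ltry.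
(* The negative part being integrable, an infinite positive part would make the integral in [Lb]
   infinite. *)
have iu : P.-integrable setT (EFin \o u).
  apply/integrableP; split; first exact/measurable_EFinP.
  rewrite (_ : (fun x => _) = (fun x => (EFin \o u)^\+ x + (EFin \o u)^\- x)%E); last first.
    by apply/funext => x; exact: (congr1 (@^~ x) (fune_abse (EFin \o u))).
  rewrite ge0_integralD//; last 2 first.
  - exact/measurable_funepos/measurable_EFinP.
  - exact/measurable_funeneg/measurable_EFinP.
  apply: lte_add_pinfty => //.
  rewrite ltNge leye_eq; apply/negP => /eqP upos.
  move: Lb; rewrite integralE.
  have -> : (\int[P]_x ((fun x => (ln (r x))%:E)^\+ x) = +oo)%E by exact: upos.
  rewrite addye ?leye_eq//.
  by rewrite eqe_oppLR /= lt_eqF.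
set c := ln (mean Q (fun x => expR (h x))).
have mQ0 := mean_expR_gt0 Q bh.
have bhc : bmeas (fun x => h x - c) by apply: bmeasB => //; exact: bmeas_cst.
have mhc : mean Q (fun x => expR (h x - c)) = 1.
  rewrite (_ : (fun x => _) = fun x => expR (- c) * expR (h x)).
    rewrite meanZ; last exact: bmeas_expR.
    by rewrite expRN lnK// mulVf// gt_eqF.
  by apply/funext => x; rewrite expRD mulrC.
have ihc := bmeas_integrable P bhc.
have i1 : P.-integrable setT (fun x => ((h x - c) - u x)%:E).
  by have := integrableB measurableT ihc iu.
have : (\int[P]_x ((1 + (h x - c - u x))%:E) <= 1)%E.
  have := int_exp _ bhc; rewrite mhc; apply: le_trans.
  have mexp : measurable_fun setT (fun x => (expR (h x - c - u x))%:E).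
    apply/measurable_EFinP/(measurableT_comp (@measurable_expR R)).
    by apply: measurable_funB => //; case: bhc.
  apply: le_integral => //.
  - have := integrableD measurableT (bmeas_integrable P (bmeas_cst 1)) i1.
    by apply.
  - apply/integrableP; split => //.
    under eq_integral do rewrite gee0_abs ?lee_fin ?expR_ge0//.
    by apply: le_lt_trans (int_exp _ bhc) _; rewrite ltry.
  by move=> x _; rewrite lee_fin; exact: expR_ge1Dx.
rewrite (_ : (fun x => _) = (fun x => 1%:E + (h x - c - u x)%:E)%E); last first.
  by apply/funext => x; rewrite EFinD.
rewrite integralD//; last exact: (bmeas_integrable P (bmeas_cst 1)).
rewrite -(meanE P (bmeas_cst 1)) mean_cst.
rewrite (_ : (fun x => _) = (fun x => (h x - c)%:E - (u x)%:E)%E); last first.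
  by apply/funext => x; rewrite EFinB.
rewrite integralB// -meanE// meanB//; last exact: bmeas_cst.
rewrite mean_cst.
have /fineK <- : (\int[P]_x (u x)%:E)%E \is a fin_num.
  exact: (integrable_fin_num _ iu).
move: Lb; have /fineK <- : (\int[P]_x (ln (r x))%:E)%E \is a fin_num.
  exact: (integrable_fin_num _ iu).
rewrite -EFinB -EFinD !lee_fin.
rewrite -/(u); set I := fine _; set J := fine _.
have -> : J = I by [].
lra.
Qed.

(** The derivative in [dKL] is exchanged for a version that is nonnegative and finite everywhere.
    The two agree Q-almost everywhere, hence P-almost everywhere as P is dominated by Q, so the
    integral of the logarithm is unchanged. *)
Lemma DV_dKL P Q (b : R) : (dKL P Q <= b%:E)%E -> DV_bound P Q b.
Proof.
rewrite /dKL; case: asboolP => [PQ|_]; last by rewrite leye_eq.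
set f := Radon_Nikodym_SigmaFinite.f P Q.
have f0 : forall x, (0 <= f x)%E by exact: Radon_Nikodym_SigmaFinite.f_ge0.
have ffin : forall x, f x \is a fin_num by exact: Radon_Nikodym_SigmaFinite.f_fin_num.
have mf : measurable_fun setT f.
  exact: measurable_int (Radon_Nikodym_SigmaFinite.f_integrable PQ).
have PfQ : ae_eq P setT f (Radon_Nikodym (charge_of_finite_measure P) Q).
  apply: (null_dominates_ae_eq _ PQ) => //.
  exact: ae_eq_Radon_Nikodym_SigmaFinite.
move=> Lb; apply: (@DV_density P Q (fine \o f)).
- by apply: measurableT_comp => //.
- by move=> x /=; rewrite fine_ge0.
- move=> g g0 mg; rewrite -(Radon_Nikodym_SigmaFinite.change_of_variables PQ)//.
  by apply: eq_integral => x _; rewrite /= fineK.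
- apply: le_trans Lb; rewrite le_eqVlt; apply/orP; left; apply/eqP.
  have mln (k : T -> \bar R) : measurable_fun setT k ->
      measurable_fun setT (fun x => (ln (fine (k x)))%:E).
    move=> mk; apply/measurable_EFinP.
    apply: (@measurableT_comp _ _ _ _ _ _ (@ln R) _ (fine \o k)).
      exact: measurable_ln.
    exact: measurableT_comp.
  apply: ae_eq_integral => //; first exact: mln.
    apply: mln; apply: measurable_int.
    exact: (@Radon_Nikodym_integrable _ _ _ (charge_of_finite_measure P) Q PQ).
  by apply: filterS PfQ => x /= /(_ I) ->.
Qed.

(** The test function is s / 2 (h - E_Q h) with s = sqrt b. By [mgf_le] its log-Laplace transform is
    at most s^2 / 2, so s / 2 (E_P h - E_Q h) <= 3 / 2 s^2. When 3 s > 1 the bound is trivial. *)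
Lemma DV_pinsker P Q (b : R) (h : T -> R) : DV_bound P Q b -> 0 < b ->
  bmeas h -> (forall x, 0 <= h x <= 1) ->
  mean P h <= mean Q h + Num.min 1 (3 * Num.sqrt b).
Proof.
move=> DV b0 bh h01.
have Q0 : 0 <= mean Q h by apply: mean_ge => // x; case/andP: (h01 x).
have Q1 : mean Q h <= 1 by apply: mean_le => // x; case/andP: (h01 x).
have P1 : mean P h <= 1 by apply: mean_le => // x; case/andP: (h01 x).
have [s1|s1] := leP (3 * Num.sqrt b) 1; last by lra.
set s := Num.sqrt b in s1 *.
have s0 : 0 < s by rewrite sqrtr_gt0.
have ss : s ^+ 2 = b by rewrite sqr_sqrtr// ltW.
pose k x := h x - mean Q h.
have bk : bmeas k by apply: bmeasB => //; exact: bmeas_cst.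
have k1 x : `|k x| <= 1 by rewrite ler_norml /k; have := h01 x; lra.
have mk : mean Q k = 0 by rewrite meanB ?mean_cst ?subrr//; exact: bmeas_cst.
have l1 : `|s / 2| * 1 <= 1 / 2 by rewrite ger0_norm; lra.
have := mgf_le bk ler01 k1 mk l1.
have bsk : bmeas (fun x => s / 2 * k x) by exact: bmeasZ.
have mgt := mean_expR_gt0 Q bsk.
rewrite -ler_ln ?posrE ?expR_gt0// expRK => lnle.
have := DV _ bsk; rewrite meanZ// meanB ?mean_cst//; last exact: bmeas_cst.
move=> DVs; have : s / 2 * (mean P h - mean Q h) <= s ^+ 2 + 2 * (s / 2 * 1) ^+ 2.
  by rewrite ss; apply: le_trans DVs _; rewrite lerD2l.
rewrite (_ : _ + _ = s / 2 * (3 * s)); last by field.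
rewrite ler_pM2l ?divr_gt0//; lra.
Qed.

End donsker_varadhan.

(* The induction applies the bound for n samples to the sections of h, and the
   one-sample bound to the log-Laplace transform of these sections. *)
Lemma DV_iid d (T : measurableType d) (R : realType) (P Q : probability T R)
    (b : R) n : DV_bound P Q b -> DV_bound (iid P n) (iid Q n) (n%:R * b).
Proof.
move=> DV; elim: n => [|n IH] h bh.
  by rewrite !mean_iid0 expRK mul0r add0r.
rewrite !mean_iidS//; last exact: bmeas_expR.
have [_ [M hM]] := bh.
set k := fun z => mean (iid Q n) (fun t => expR (h (cons_pair (z, t)))).
have bk : bmeas k.
  exact: (@bmeas_inner _ _ _ Q n (fun x => expR (h x)) (bmeas_expR bh)).
have k0 z : expR (- M) <= k z.
  apply: mean_ge => [|t]; first by apply: bmeas_expR; exact: bmeas_section.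
  by rewrite ler_expR; exact: lerNnormlW.
have blk : bmeas (fun z => ln (k z)) by exact: (bmeas_ln (expR_gt0 _) k0).
have h1 : mean P (fun z => mean (iid P n) (fun t => h (cons_pair (z, t)))) <=
    n%:R * b + mean P (fun z => ln (k z)).
  rewrite -[X in X + _](mean_cst P) -meanD//; last exact: bmeas_cst.
  apply: le_mean; first exact: bmeas_inner.
    by apply: bmeasD => //; exact: bmeas_cst.
  by move=> z; apply: IH; exact: bmeas_section.
have := DV _ blk.
rewrite (_ : (fun x => expR (ln (k x))) = k); last first.
  by apply/funext => z; rewrite lnK// posrE (lt_le_trans _ (k0 z))// expR_gt0.
by rewrite -natr1; lra.
Qed.

(** * Change of measure for functions stable in each coordinate *)

Section stable_functions.
Context {d : measure_display} {T : measurableType d} {R : realType}.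
Implicit Types (P Q : probability T R).

Lemma mean_osc_le P Q (tau a w : R) (g : T -> R) :
  (forall h : T -> R, bmeas h -> (forall x, 0 <= h x <= 1) ->
    mean P h <= mean Q h + tau) ->
  bmeas g -> 0 <= w -> (forall x, a <= g x <= a + w) ->
  mean P g <= mean Q g + tau * w.
Proof.
move=> PQ bg w0 ag; have [weq0|wn0] := eqVneq w 0.
  rewrite weq0 mulr0 addr0; apply: (@le_trans _ _ a).
    by apply: mean_le => // x; have /andP[_] := ag x; rewrite weq0 addr0.
  by apply: mean_ge => // x; have /andP[] := ag x.
have {wn0} w0 : 0 < w by rewrite lt_neqAle eq_sym wn0.
have bga : bmeas (fun x => g x - a) by apply: bmeasB => //; exact: bmeas_cst.
have bc := bmeas_cst.
have := PQ _ (bmeasZ w^-1 bga).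
rewrite !meanZ// !meanB// !mean_cst => H.
have {}H : w^-1 * (mean P g - a) <= w^-1 * (mean Q g - a) + tau.
  apply: H => x; have := ag x => /andP[ax axw]; apply/andP; split.
    by apply: mulr_ge0; [rewrite invr_ge0 ltW|lra].
  by rewrite ler_pdivrMl// mulr1; lra.
move: H; rewrite -(ler_pM2l w0) [leRHS]mulrDr !mulVKf ?gt_eqF//; lra.
Qed.

(** All values of g lie between mu / K and K mu, where mu = E_Q g. The oscillation is thus at most
    (K - 1 / K) mu, and its being proportional to mu turns the additive error tau into a ratio. *)
Lemma mean_ratio_le P Q (tau K : R) (g : T -> R) :
  (forall h : T -> R, bmeas h -> (forall x, 0 <= h x <= 1) ->
    mean P h <= mean Q h + tau) ->
  1 <= K -> bmeas g -> (forall x, 0 <= g x) ->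
  (forall x x', g x <= K * g x') ->
  mean P g <= (1 + (K - K^-1) * tau) * mean Q g.
Proof.
move=> PQ K1 bg g0 gK.
have K0 : 0 < K by lra.
set mu := mean Q g.
have mu0 : 0 <= mu by exact: mean_ge.
have gle x : g x <= K * mu.
  by rewrite -meanZ//; apply: mean_ge => //; exact: bmeasZ.
have gge x : K^-1 * mu <= g x.
  by rewrite ler_pdivrMl//; exact: mean_le.
have KV1 : K^-1 <= 1 by rewrite invf_le1.
have w0 : 0 <= (K - K^-1) * mu by apply: mulr_ge0 => //; lra.
have := @mean_osc_le P Q tau (K^-1 * mu) _ g PQ bg w0.
have ag x : K^-1 * mu <= g x <= K^-1 * mu + (K - K^-1) * mu.
  by rewrite gge/= -mulrDl addrC subrK.
by move=> /(_ ag); rewrite -/mu; lra.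
Qed.

(** The samples are exchanged one at a time: the induction handles the tail for a fixed first
    sample, then [mean_ratio_le] handles the first one, the inner mean being as stable in it as
    G. *)
Lemma mean_iid_ratio_le P Q (tau K : R) n (G : n.-tuple T -> R) :
  (forall h : T -> R, bmeas h -> (forall x, 0 <= h x <= 1) ->
    mean P h <= mean Q h + tau) ->
  0 <= tau -> 1 <= K -> bmeas G -> (forall x, 0 <= G x) ->
  (forall (x x' : n.-tuple T) i, (forall j, j != i -> tnth x j = tnth x' j) ->
    G x <= K * G x') ->
  mean (iid P n) G <= (1 + (K - K^-1) * tau) ^+ n * mean (iid Q n) G.
Proof.
move=> PQ tau0 K1; have K0 : 0 < K by lra.
have k0 : 0 <= 1 + (K - K^-1) * tau.
  have KV1 : K^-1 <= 1 by rewrite invf_le1.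
  by rewrite addr_ge0// mulr_ge0//; lra.
elim: n G => [|n IH] G bG G0 GK; first by rewrite !mean_iid0 expr0 mul1r.
rewrite !mean_iidS//.
have bi := @bmeas_inner _ _ _ Q n G bG.
apply: (@le_trans _ _ (mean P (fun z => (1 + (K - K^-1) * tau) ^+ n *
    mean (iid Q n) (fun t => G (cons_pair (z, t)))))).
  apply: le_mean => [||z]; [exact: bmeas_inner|exact: bmeasZ|].
  apply: IH => [|t|t t' i tt']; [exact: bmeas_section|exact: G0|].
  apply: (GK _ _ (lift ord0 i)) => j.
  case: (unliftP ord0 j) => [k ->|->]; last by rewrite !tnth0.
  by rewrite !tnthS => ki; apply: tt'; apply: contra ki => /eqP ->.
rewrite meanZ// exprSr -mulrA ler_wpM2l ?exprn_ge0//.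
apply: mean_ratio_le => // [z|z z'].
  by apply: mean_ge => [|t]; [exact: bmeas_section|exact: G0].
rewrite -meanZ; last exact: bmeas_section.
apply: le_mean => [||t]; [exact: bmeas_section|exact/bmeasZ/bmeas_section|].
apply: (GK _ _ ord0) => j.
by case: (unliftP ord0 j) => [k ->|->]; rewrite ?eqxx// !tnthS.
Qed.

End stable_functions.

(** * Total variation balls and enumeration of finite families *)

Section total_variation.
Context {d : measure_display} {Z : measurableType d} {R : realType}.
Implicit Types (P Q : probability Z R).

Lemma dTV_leP P Q (a : R) : (dTV P Q <= a%:E)%E <->
  forall A, measurable A -> `|mean P (\1_A) - mean Q (\1_A)| <= a.
Proof.
have PQE A : measurable A ->
    (`|P A - Q A|)%E = (`|mean P (\1_A) - mean Q (\1_A)|)%:E.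
  by move=> mA; rewrite -!mean_indic.
split=> [PQ A mA|PQ].
  rewrite -lee_fin -PQE//; apply: le_trans PQ; apply: ereal_sup_ubound.
  by exists A.
by apply: ge_ereal_sup => _ [A mA <-]; rewrite PQE// lee_fin PQ.
Qed.

Lemma dTV_triangle P Q Q' (a b : R) :
  (dTV Q P <= a%:E)%E -> (dTV Q Q' <= b%:E)%E -> (dTV P Q' <= (a + b)%:E)%E.
Proof.
move=> /dTV_leP QP /dTV_leP QQ'; apply/dTV_leP => A mA.
have := QP A mA; have := QQ' A mA; rewrite !ler_norml; lra.
Qed.

Lemma measurable_TV_ball P (a : R) : measurable (TV_ball P a : set (learned Z R)).
Proof. by apply: sub_sigma_algebra; exists P, a. Qed.

End total_variation.

Lemma has_size_enum (R : realType) (T : Type) (QQ : set T) (L : R) :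
  has_size QQ L -> exists N (q : 'I_N -> T), [/\ (0 < N)%N, L = ln N%:R,
    injective q, (forall i, QQ (q i)) & (forall Q, QQ Q -> exists i, q i = Q)].
Proof.
move=> [N [N0 QN ->]]; exists N.
move: QN => /card_esym/card_bijP[f fbij].
pose q (i : 'I_N) := set_val (f (SigSub (mem_set (ltn_ord i : `I_N i)))).
exists q; split => //.
- move=> i j /val_inj /(bij_inj fbij) /(congr1 val)/= ij; exact: val_inj.
- by move=> i; exact: set_valP.
- move=> Q QQQ; have [g gK fK] := fbij.
  pose x := g (SigSub (mem_set QQQ)).
  exists (Ordinal (set_valP x : set_val x < N)%N); rewrite /q.
  rewrite (_ : SigSub _ = x); last exact: val_inj.
  by rewrite /x fK.
Qed.

(** * Number of users forced by a packing *)

Section lower_bound.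
Context {d : measure_display} {Z : measurableType d} {R : realType}.

Lemma dlearn_lower (PP QQ : set (probability Z R)) (m : nat)
    (alpha beta eps L : R) n
    (A : R.-pker (n.-tuple (m.-tuple Z)) ~> learned Z R) :
  (0 < m)%N -> 0 < alpha -> 0 < beta -> 0 < eps <= 1 / 2 ->
  has_size QQ L -> is_packing (@dTV d Z R) (3 * alpha) PP QQ ->
  (diameter (@dKL d Z R) QQ <= beta%:E)%E ->
  user_level_DP eps 0 A -> solves (dlearn PP alpha) A ->
  L / eps + L / (eps * Num.sqrt (m%:R * beta)) + L / (m%:R * beta) <= 18 * n%:R.
Proof.
move=> m0 alpha0 beta0 /andP[eps0 eps1] /has_size_enum[N [q [N0 -> qinj qQ _]]].
move=> [QPP pack] diam DP sol.
(* A single hypothesis has size ln 1 = 0, so the left-hand side vanishes. *)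
have [N1|N2] := leqP N 1.
  have -> : N = 1%N by apply/eqP; rewrite eqn_leq N1 N0.
  by rewrite ln1 !mul0r !addr0 mulr_ge0.
set b := m%:R * beta.
have b0 : 0 < b by rewrite mulr_gt0// ltr0n.
set s := Num.sqrt b.
have s0 : 0 < s by rewrite sqrtr_gt0.
(* The Pinsker bound for the data of one user, whose m samples have divergence at most b. *)
set tau := Num.min 1 (3 * s).
have tau0 : 0 <= tau by rewrite /tau le_min ler01 mulr_ge0 ?ltW.
have tau1 : tau <= 1 by rewrite ge_min lexx.
have tau3 : tau <= 3 * s by rewrite ge_min lexx orbT.
pose E i : set (learned Z R) := TV_ball (q i) alpha.
have mE i : measurable (E i) by exact: measurable_TV_ball.
(* A common point of two balls would put their centres within 2 alpha, against the separation 3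
   alpha. *)
have tE : trivIset setT E.
  apply/trivIsetP => i j _ _ ij; rewrite -subset0 => Q [Ei Ej].
  have := dTV_triangle Ei Ej.
  have qij : q i <> q j by move=> /qinj /eqP; rewrite (negbTE ij).
  have := pack _ _ (qQ i) (qQ j) qij => /le_trans h /h.
  by rewrite lee_fin; lra.
pose a i x := fine (A x (E i)).
have Ale1 x (S : set (learned Z R)) : measurable S -> (A x S <= 1)%E.
  by move=> mS; rewrite -(@prob_kernel _ _ _ _ _ A x); apply: le_measure => //; rewrite inE.
have Afin x (S : set (learned Z R)) : measurable S -> A x S \is a fin_num.
  by move=> mS; rewrite ge0_fin_numE// (le_lt_trans (Ale1 x S mS))// ltry.
have aE i x : (a i x)%:E = A x (E i) by rewrite fineK//; exact: Afin.
have a0 i x : 0 <= a i x by rewrite fine_ge0.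
have a1 i x : a i x <= 1 by rewrite -lee_fin aE Ale1.
have ba i : bmeas (a i).
  split; last by exists 1 => x; rewrite ger0_norm.
  apply: measurableT_comp => //; exact: measurable_kernel.
have sol' i : 2 / 3 <= mean (iid (iid (q i) m) n) (a i).
  rewrite -lee_fin meanE//; apply: le_trans (sol _ (QPP _ (qQ i))) _.
  by rewrite le_eqVlt; apply/orP; left; apply/eqP; apply: eq_integral => x _; rewrite aE.
have asum x : \sum_i a i x <= 1.
  rewrite -lee_fin -sumEFin; under eq_bigr do rewrite aE.
  rewrite -(@measure_bigsetU_ord _ _ _ (A x) _ xpredT E)//.
  by apply: Ale1; exact: bigsetU_measurable.
pose i0 := Ordinal N0.
pose Q0 := iid (iid (q i0) m) n.
(* The failure mass 1/3 of the first hypothesis is shared by the N - 1 others. *)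
have [j ji0 qj] : exists2 j, j != i0 & mean Q0 (a j) <= (3 * (N%:R - 1))^-1.
  apply: contrapT => H.
  have {}H j : j != i0 -> (3 * (N%:R - 1))^-1 < mean Q0 (a j).
    move=> ji; have [h|//] := leP (mean Q0 (a j)) (3 * (N%:R - 1))^-1.
    by exfalso; apply: H; exists j.
  have : \sum_i mean Q0 (a i) <= 1.
    by rewrite -mean_sum//; apply: mean_le => //; exact: bmeas_sum.
  apply/negP; rewrite -ltNge (bigD1 i0)//=.
  have : \sum_(j < N | j != i0) (3 * (N%:R - 1))^-1 < \sum_(j < N | j != i0) mean Q0 (a j).
    apply: ltr_sum => //; apply/hasP; exists (Ordinal N2) => //.
  rewrite sumr_const cardC1 card_ord -[_ *+ N.-1]mulr_natl.
  have -> : N.-1%:R = N%:R - 1 :> R by rewrite -subn1 natrB.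
  rewrite invfM mulrCA divff; last by rewrite subr_eq0 pnatr_eq1 gtn_eqF.
  by have := sol' i0; rewrite -/Q0; lra.
have NR : 2 <= N%:R :> R by rewrite ler_nat.
have lnN0 : 0 <= ln (N%:R : R) by rewrite ln_ge0//; lra.
have KLj : (dKL (q j) (q i0) <= beta%:E)%E.
  by apply: le_trans diam; apply: ereal_sup_ubound; exists (q j) => //; exists (q i0).
have DVm : DV_bound (iid (q j) m) (iid (q i0) m) b by exact/DV_iid/DV_dKL.
(* As e^eps <= 1 + 2 eps and e^-eps >= 1 - eps, each user contributes a factor at most 1 + 3 eps
   tau. Comparing 2 / 3 with 1 / (3 (N - 1)) leaves 2 (N - 1) <= e^(3 eps tau n), and N <= 2 (N -
   1). *)
have bound1 : ln N%:R <= 3 * eps * tau * n%:R.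
  pose K := expR eps.
  have K1 : 1 <= K by have := expR_ge1Dx eps; rewrite -/K; lra.
  have KV : 1 - eps <= K^-1 by rewrite -expRN; exact: expR_ge1Dx.
  have KV1 : K^-1 <= 1 by rewrite invf_le1//; lra.
  have KE : K <= 1 + 2 * eps.
    have : K <= 1 + eps + 2 * eps ^+ 2.
      by apply: expR_le1DxD2x2; rewrite ger0_norm//; exact: ltW.
    nra.
  have GK (x x' : n.-tuple (m.-tuple Z)) i :
      (forall k, k != i -> tnth x k = tnth x' k) -> a j x <= K * a j x'.
    move=> xx'; have /(_ (E j) (mE j)) := DP x x' (ex_intro _ i xx').
    by rewrite -!aE adde0 -EFinM lee_fin.
  have PQ (h : m.-tuple Z -> R) : bmeas h -> (forall x, 0 <= h x <= 1) ->
      mean (iid (q j) m) h <= mean (iid (q i0) m) h + tau.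
    by move=> bh h01; exact: DV_pinsker.
  have := mean_iid_ratio_le PQ tau0 K1 (ba j) (a0 j) GK.
  have kle : (1 + (K - K^-1) * tau) ^+ n <= expR (3 * eps * tau * n%:R).
    rewrite expRM_natr lerXn2r ?nnegrE ?expR_ge0//.
      by rewrite addr_ge0// mulr_ge0//; lra.
    apply: le_trans (expR_ge1Dx _); rewrite lerD2l ler_wpM2r//; lra.
  rewrite -/Q0 => H.
  have {}H : 2 / 3 <= expR (3 * eps * tau * n%:R) * (3 * (N%:R - 1))^-1.
    apply: le_trans (sol' j) _; apply: le_trans H _.
    by apply: ler_pM => //; [rewrite exprn_ge0// addr_ge0// mulr_ge0//; lra|exact: mean_ge].
  rewrite ler_pdivlMr in H; last by lra.
  rewrite -[leRHS]expRK ler_ln ?posrE ?expR_gt0//; lra.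
(* The mean of [H] under the j-th hypothesis is at least 2 / 3 ln N, while ln E e^H under the first
   one is at most 1 / 2 ln N; the difference is 1 / 6. *)
have bound2 : ln N%:R / 6 <= n%:R * b.
  have DVn := DV_iid (n := n) DVm.
  pose H x := ln (1 + (N%:R - 1) * a j x).
  have bH1 : bmeas (fun x => 1 + (N%:R - 1) * a j x).
    by apply: bmeasD; [exact: bmeas_cst|exact: bmeasZ].
  have H1 x : 1 <= 1 + (N%:R - 1) * a j x by rewrite lerDl mulr_ge0//; lra.
  have bH : bmeas H by exact: (bmeas_ln ltr01).
  have := DVn _ bH.
  rewrite (_ : (fun x => expR (H x)) = fun x => 1 + (N%:R - 1) * a j x); last first.
    by apply/funext => x; rewrite lnK// posrE (lt_le_trans ltr01).
  rewrite meanD ?mean_cst ?meanZ//; [|exact: bmeas_cst|exact: bmeasZ].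
  rewrite -/Q0 => DVH.
  (* Convexity of exp between 0 and ln N: N^t <= 1 + (N - 1) t. *)
  have Hge x : ln N%:R * a j x <= H x.
    rewrite -[leLHS]expRK ler_ln ?posrE ?expR_gt0//; last exact: lt_le_trans ltr01 (H1 x).
    pose t := Itv01 (a0 j x) (a1 j x).
    have := @convex_expR R t (ln N%:R) 0.
    rewrite !convRE/= /unstable.onem expR0 mulr0 addr0 lnK ?posrE; last lra.
    rewrite mulrC; lra.
  have : ln N%:R * (2 / 3) <= mean (iid (iid (q j) m) n) H.
    apply: (@le_trans _ _ (ln N%:R * mean (iid (iid (q j) m) n) (a j))).
      by rewrite ler_wpM2l.
    by rewrite -meanZ//; apply: le_mean => //; exact: bmeasZ.
  (* The argument is at most 4 / 3, and 16 / 9 <= 2 <= N. *)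
  have : ln (1 + (N%:R - 1) * mean Q0 (a j)) <= ln N%:R / 2.
    have Q00 : 0 <= mean Q0 (a j) by exact: mean_ge.
    have r13 : (N%:R - 1) * mean Q0 (a j) <= 1 / 3.
      apply: le_trans (ler_wpM2l _ qj) _; first lra.
      rewrite invfM mulrCA divff ?mulr1 ?mul1r//; lra.
    have r0 : 0 <= (N%:R - 1) * mean Q0 (a j) by rewrite mulr_ge0//; lra.
    rewrite ler_pdivlMr// mulr_natr -lnXn; last lra.
    rewrite ler_ln ?posrE; [|by rewrite exprn_gt0//; lra|lra].
    apply: (@le_trans _ _ ((4 / 3) ^+ 2)); last lra.
    by rewrite lerXn2r ?nnegrE; lra.
  lra.
(* The first term uses tau <= 1, the second tau <= 3 s; the constants add up to 3 + 9 + 6 = 18. *)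
have e1 : ln N%:R / eps <= 3 * n%:R.
  rewrite ler_pdivrMr//; apply: le_trans bound1 _.
  have : tau * (eps * n%:R) <= 1 * (eps * n%:R).
    by rewrite ler_wpM2r// mulr_ge0// ltW.
  lra.
have e2 : ln N%:R / (eps * s) <= 9 * n%:R.
  rewrite ler_pdivrMr ?mulr_gt0//; apply: le_trans bound1 _.
  have : tau * (eps * n%:R) <= 3 * s * (eps * n%:R).
    by rewrite ler_wpM2r// mulr_ge0// ltW.
  lra.
have e3 : ln N%:R / b <= 6 * n%:R by rewrite ler_pdivrMr//; lra.
lra.
Qed.

End lower_bound.

(** * Upper bound *)

Section finite_mixture_kernel.
Context {d d' : measure_display} {X : measurableType d} {Y : measurableType d'}
  {R : realType}.
Variables (N : nat) (p : 'I_N.+1 -> X -> R) (o : 'I_N.+1 -> Y).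
Hypothesis p0 : forall i x, 0 <= p i x.
Hypothesis p1 : forall x, \sum_i p i x = 1.
Hypothesis bp : forall i, bmeas (p i).

(** [msum] is indexed by naturals; [inord] leads back to ordinals, which asks for an index type of
    the form ['I_N.+1]. *)
Let mix (x : X) : {measure set Y -> \bar R} :=
  msum (fun i => mscale (NngNum (p0 (inord i) x)) (dirac (o (inord i)))) N.+1.

Let mixE x (S : set Y) : mix x S = (\sum_i p i x * \1_S (o i))%:E.
Proof.
rewrite /mix /= /msum -sumEFin; apply: eq_bigr => i _.
by rewrite inord_val /= /mscale /= diracE indicE EFinM.
Qed.

Let measurable_mix S : measurable S -> measurable_fun setT (mix ^~ S).
Proof.
move=> mS; rewrite (_ : mix ^~ S = EFin \o fun x => \sum_i p i x * \1_S (o i)).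
  apply/measurable_EFinP.
  have : bmeas (fun x => \sum_i p i x * \1_S (o i)).
    by apply: bmeas_sum => i; apply: bmeasM => //; exact: bmeas_cst.
  by case.
by apply/funext => x; rewrite mixE.
Qed.

HB.instance Definition _ := isKernel.Build _ _ _ _ _ mix measurable_mix.

Let mix_prob x : mix x setT = 1%E.
Proof.
rewrite mixE; congr EFin; rewrite -(p1 x); apply: eq_bigr => i _.
by rewrite indicE in_setT mulr1.
Qed.

HB.instance Definition _ := Kernel_isProbability.Build _ _ _ _ _ mix mix_prob.

Lemma finite_mixture_kernel : exists A : R.-pker X ~> Y,
  forall x (S : set Y), A x S = (\sum_i p i x * \1_S (o i))%:E.
Proof. by exists mix; exact: mixE. Qed.

End finite_mixture_kernel.

Lemma expR_half_le2 (R : realType) : expR (1 / 2) <= 2 :> R.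
Proof.
have := @expR_le1DxD2x2 R (1 / 2); rewrite ger0_norm; last lra.
by move=> /(_ (lexx _)); lra.
Qed.

(** * Bias caused by clipping *)

Section clip.
Context {R : realType}.

Definition clip (x : R) : R := Num.max (-1) (Num.min 1 x).

Lemma clip_norm (x : R) : `|clip x| <= 1.
Proof.
rewrite ler_norml /clip le_max lexx/= ge_max; apply/andP; split; first lra.
by rewrite ge_min lexx.
Qed.

Lemma le_clip (x y : R) : x <= y -> clip x <= clip y.
Proof.
move=> xy; rewrite /clip; case: (leP 1 x); case: (leP 1 y) => ? ?;
  by rewrite ge_max !le_max lexx/=; lra.
Qed.

(** Clipping acts only if |y| > 1 / 2, with error at most z = |y| - 1 / 2. Then l z <= e^(l z), and
    e^(l |y|) is one of the two exponentials. *)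
Lemma clip_err (mu y l : R) : 0 < l -> `|mu| <= 1 / 2 ->
  `|clip (mu + y) - (mu + y)| <=
    l^-1 * expR (- (l / 2)) * (expR (l * y) + expR (- l * y)).
Proof.
move=> l0; rewrite ler_norml => /andP[mu1 mu2].
have [h|h] := leP `|y| (1 / 2).
  move: h; rewrite ler_norml => /andP[y1 y2].
  have -> : clip (mu + y) = mu + y.
    by rewrite /clip min_r ?max_r//; lra.
  by rewrite subrr normr0 !mulr_ge0 ?addr_ge0 ?invr_ge0 ?expR_ge0 ?ltW.
apply: (@le_trans _ _ (`|y| - 1 / 2)).
  rewrite ler_norml /clip.
  have [y0|y0] := leP 0 y.
    rewrite (ger0_norm y0) in h *.
    case: (leP 1 (mu + y)) => c1; case: (leP (-1)) => c2; lra.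
  rewrite (ltr0_norm y0) in h *.
  case: (leP 1 (mu + y)) => c1; case: (leP (-1)) => c2; lra.
have le1 : l * (`|y| - 1 / 2) <= expR (l * (`|y| - 1 / 2)).
  by have := expR_ge1Dx (l * (`|y| - 1 / 2)); lra.
rewrite -mulrA ler_pdivlMl//; apply: le_trans le1 _.
rewrite (_ : l * (`|y| - 1 / 2) = - (l / 2) + l * `|y|); last by ring.
rewrite expRD ler_wpM2l ?expR_ge0//.
have e1 := expR_ge0 (l * y); have e2 := expR_ge0 (- l * y).
have [y0|y0] := leP 0 y; first by rewrite ger0_norm//; lra.
by rewrite ltr0_norm// mulrN -mulNr; lra.
Qed.

Lemma bmeas_clip d (T : measurableType d) (f : T -> R) : bmeas f ->
  bmeas (fun x => clip (f x)).
Proof.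
by move=> bf; apply: bmeas_max; [|apply: bmeas_min => //]; exact: bmeas_cst.
Qed.

Lemma mean_clip_bias d (T : measurableType d) (P : probability T R)
    (Y : T -> R) (mu l : R) : bmeas Y -> mean P Y = 0 -> 0 < l ->
  mean P (fun x => expR (l * Y x)) <= 2 ->
  mean P (fun x => expR (- l * Y x)) <= 2 -> `|mu| <= 1 / 2 ->
  `|mean P (fun x => clip (mu + Y x)) - mu| <= 4 * l^-1 * expR (- (l / 2)).
Proof.
move=> bY Y0 l0 e1 e2 mu12.
have bc := bmeas_cst; have bmY : bmeas (fun x => mu + Y x) by exact: bmeasD.
have bcl := bmeas_clip bmY.
have be k : bmeas (fun x => expR (k * Y x)) by apply: bmeas_expR; exact: bmeasZ.
set C := l^-1 * expR (- (l / 2)).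
have C0 : 0 <= C by rewrite mulr_ge0 ?expR_ge0// invr_ge0 ltW.
have -> : mean P (fun x => clip (mu + Y x)) - mu =
    mean P (fun x => clip (mu + Y x) - (mu + Y x)).
  by rewrite meanB// meanD// mean_cst Y0 addr0.
have bdiff : bmeas (fun x => clip (mu + Y x) - (mu + Y x)) by exact: bmeasB.
have bsum : bmeas (fun x => expR (l * Y x) + expR (- l * Y x)) by exact: bmeasD.
have Cs : C * mean P (fun x => expR (l * Y x) + expR (- l * Y x)) <= 4 * C.
  by rewrite mulrC ler_wpM2r// meanD//; lra.
apply: le_trans (_ : C * mean P (fun x => expR (l * Y x) + expR (- l * Y x)) <= _); last first.
  by apply: le_trans Cs _; rewrite mulrA.
rewrite -meanZ// ler_norml -[X in X <= _ <= _]mulN1r -meanZ; last exact: bmeasZ.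
apply/andP; split; apply: le_mean => //; do ?[exact: bmeasZ|exact/bmeasZ/bmeasZ].
  by move=> x; have := clip_err (Y x) l0 mu12; rewrite ler_norml => /andP[+ _]; rewrite mulN1r.
by move=> x; have := clip_err (Y x) l0 mu12; rewrite ler_norml => /andP[_ +].
Qed.

End clip.

(** * The clipped statistic of one user *)

Section user_statistic.
Context {d : measure_display} {Z : measurableType d} {R : realType}.

Definition user_stat (W : set Z) (q B : R) m (y : m.-tuple Z) : R :=
  clip ((m%:R^-1 * (\sum_v \1_W (tnth y v)) - q) / B).

Lemma bmeas_user_stat (W : set Z) (q B : R) m : measurable W ->
  bmeas (@user_stat W q B m).
Proof.
move=> mW; apply: bmeas_clip.
apply: bmeasM; last exact: bmeas_cst.
apply: bmeasB; last exact: bmeas_cst.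
apply/bmeasZ/bmeas_sum => v.
exact: (@bmeas_tnth _ _ _ m v (\1_W) (bmeas_indic mW)).
Qed.

Lemma user_stat_anti (W : set Z) (q q' B : R) m (y : m.-tuple Z) : 0 < B ->
  q <= q' -> user_stat W q' B y <= user_stat W q B y.
Proof. by move=> B0 qq'; apply: le_clip; rewrite ler_pM2r ?invr_gt0//; lra. Qed.

(** The statistic is the clipping of (p - q) / B + Y, where p = D(W) and Y is the centred empirical
    frequency divided by B, so [mean_clip_bias] applies. *)
Lemma mean_user_stat (D : probability Z R) (W : set Z) (q B : R) m :
  measurable W -> (0 < m)%N -> 0 < B -> `|mean D (\1_W) - q| <= B / 2 ->
  `|mean (iid D m) (@user_stat W q B m) - (mean D (\1_W) - q) / B| <=
  8 / (B * Num.sqrt m%:R) * expR (- (B * Num.sqrt m%:R / 4)).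
Proof.
move=> mW m0 B0; set p := mean D (\1_W) => pq.
have m0R : 0 < m%:R :> R by rewrite ltr0n.
set s := Num.sqrt (m%:R : R).
have s0 : 0 < s by rewrite sqrtr_gt0.
have s1 : 1 <= s by rewrite -sqrtr1 ler_sqrt// ler1n.
have ss : s ^+ 2 = m%:R by rewrite sqr_sqrtr// ltW.
have bW : bmeas (\1_W : Z -> R) by exact: bmeas_indic.
pose f z : R := \1_W z - p.
have bf : bmeas f by apply: bmeasB => //; exact: bmeas_cst.
have mf : mean D f = 0 by rewrite meanB ?mean_cst ?subrr//; exact: bmeas_cst.
have W01 z : 0 <= (\1_W z : R) <= 1 by rewrite indicE; case: (_ \in _) => /=; lra.
have p01 : 0 <= p <= 1.
  apply/andP; split; first by apply: mean_ge => // z; case/andP: (W01 z).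
  by apply: mean_le => // z; case/andP: (W01 z).
have f1 z : `|f z| <= 1 by rewrite ler_norml /f; have := W01 z; lra.
pose Y (y : m.-tuple Z) := (m%:R * B)^-1 * \sum_v f (tnth y v).
have bS : bmeas (fun y : m.-tuple Z => \sum_v f (tnth y v)).
  by apply: bmeas_sum => v; exact: bmeas_tnth.
have bY : bmeas Y by exact: bmeasZ.
have Y0 : mean (iid D m) Y = 0.
  rewrite meanZ// (@mean_sum _ _ _ _ _ _ _ (fun v y => f (tnth y v))); last first.
    by move=> v; exact: bmeas_tnth.
  by rewrite big1 ?mulr0// => v _; rewrite mean_iid_tnth.
(* With this l, the exponent l Y is the centred sum divided by 2 sqrt m, and [mgf_iid_le] gives e^(1
   / 2) <= 2. *)
pose l := B * s / 2.
have l0 : 0 < l by rewrite divr_gt0// mulr_gt0.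
have mgfY k : `|k| = 1 -> mean (iid D m) (fun y => expR (k * l * Y y)) <= 2.
  move=> k1; have c12 : `|k / (2 * s)| * 1 <= 1 / 2.
    have s20 : 0 <= (2 * s)^-1 by rewrite invr_ge0; lra.
    rewrite mulr1 normrM k1 mul1r (ger0_norm s20).
    by rewrite div1r lef_pV2 ?posrE; lra.
  have := mgf_iid_le m bf ler01 f1 mf c12.
  rewrite (_ : m%:R * _ = 1 / 2); last first.
    rewrite -ss mulr1 exprMn -(real_normK (num_real k)) k1 expr1n; field.
    exact: lt0r_neq0.
  rewrite (_ : (fun y => expR (k * l * Y y)) =
      fun y : m.-tuple Z => expR (k / (2 * s) * \sum_i f (tnth y i))).
    by move=> /le_trans; apply; exact: expR_half_le2.
  apply/funext => y; congr expR; rewrite /l /Y -ss mulrA; congr (_ * _).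
  by field; rewrite !gt_eqF.
have := @mean_clip_bias R _ _ (iid D m) Y ((p - q) / B) l bY Y0 l0.
rewrite (_ : (fun x => clip _) = @user_stat W q B m); last first.
  apply/funext => y; rewrite /user_stat; congr clip; rewrite /Y.
  rewrite (_ : \sum_v f (tnth y v) = \sum_v \1_W (tnth y v) - m%:R * p); last first.
    by rewrite /f sumrB sumr_const card_ord mulr_natl.
  by field; rewrite !gt_eqF.
rewrite (_ : 4 / l = 8 / (B * s)); last by rewrite /l; field; rewrite !gt_eqF.
rewrite (_ : l / 2 = B * s / 4); last by rewrite /l; field.
apply.
- by have := mgfY 1 (normr1 _); rewrite mul1r.
- by have := mgfY (-1) (normrN1 _); rewrite mulN1r.
- have BV0 : 0 <= B^-1 by rewrite invr_ge0 ltW.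
  by rewrite normrM (ger0_norm BV0) ler_pdivrMr//; lra.
Qed.

End user_statistic.

Section user_statistic_separation.
Context {d : measure_display} {Z : measurableType d} {R : realType}.

(** The left-hand side is the bias bound of [mean_user_stat], compared with a tenth of the accuracy
    alpha measured in units of B. *)
Definition small_bias (alpha B : R) (m : nat) :=
  8 / (B * Num.sqrt m%:R) * expR (- (B * Num.sqrt m%:R / 4)) <= alpha / B / 10.

Lemma mean_user_stat_near (D : probability Z R) (W : set Z) (q alpha B : R)
    (m : nat) : measurable W -> (0 < m)%N -> 0 < alpha -> alpha <= B ->
  small_bias alpha B m -> `|mean D (\1_W) - q| <= alpha / 10 ->
  `|mean (iid D m) (@user_stat _ _ _ W q B m)| <= alpha / B / 5.
Proof.
move=> mW m0 alpha0 alphaB bias; set p := mean D _ => pq.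
have B0 : 0 < B by lra.
have pqB : `|p - q| <= B / 2 by lra.
have := mean_user_stat mW m0 B0 pqB.
move=> /le_trans /(_ bias); set mu := mean _ (user_stat _ _ _ (m:=m)) => H.
have : `|(p - q) / B| <= alpha / B / 10.
  have BV0 : 0 <= B^-1 by rewrite invr_ge0 ltW.
  by rewrite normrM (ger0_norm BV0) mulrAC ler_wpM2r.
move: H; rewrite !ler_norml -/p; lra.
Qed.

(* By monotonicity in q, the mean is at least the one for the closer value
   p -/+ alpha / 2, where the clipping is harmless. *)
Lemma mean_user_stat_far (D : probability Z R) (W : set Z) (q alpha B : R)
    (m : nat) : measurable W -> (0 < m)%N -> 0 < alpha -> alpha <= B ->
  small_bias alpha B m -> 4 / 5 * alpha <= `|mean D (\1_W) - q| ->
  2 / 5 * (alpha / B) <= `|mean (iid D m) (@user_stat _ _ _ W q B m)|.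
Proof.
move=> mW m0 alpha0 alphaB bias; set p := mean D _ => pq.
have B0 : 0 < B by lra.
have aB : (alpha / 2) / B = alpha / B / 2 by rewrite mulrAC.
have [h|h] := leP q p.
  rewrite ger0_norm in pq; last lra.
  have q' : `|p - (p - alpha / 2)| <= B / 2.
    by rewrite opprB addrC subrK ger0_norm; lra.
  have := mean_user_stat mW m0 B0 q'; move=> /le_trans /(_ bias).
  have : mean (iid D m) (@user_stat _ _ _ W (p - alpha / 2) B m) <=
      mean (iid D m) (@user_stat _ _ _ W q B m).
    apply: le_mean => [||y]; [exact: bmeas_user_stat..|].
    by apply: user_stat_anti => //; lra.
  rewrite -/p (_ : p - (p - alpha / 2) = alpha / 2); last lra.
  rewrite aB ler_norml => H1 /andP[H2 _].
  apply: le_trans (ler_norm _); lra.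
rewrite ltr0_norm in pq; last lra.
have q' : `|p - (p + alpha / 2)| <= B / 2.
  by rewrite opprD addrA subrr add0r normrN ger0_norm; lra.
have := mean_user_stat mW m0 B0 q'; move=> /le_trans /(_ bias).
have : mean (iid D m) (@user_stat _ _ _ W q B m) <=
    mean (iid D m) (@user_stat _ _ _ W (p + alpha / 2) B m).
  apply: le_mean => [||y]; [exact: bmeas_user_stat..|].
  by apply: user_stat_anti => //; lra.
rewrite -/p (_ : p - (p + alpha / 2) = - (alpha / 2)); last lra.
rewrite mulNr aB ler_norml => H1 /andP[_ H2].
rewrite -normrN; apply: le_trans (ler_norm _); lra.
Qed.

End user_statistic_separation.

(** * Utility and stability of softmax weights *)

Lemma softmax_bad_mass (R : realType) (I : finType) (s : I -> R) (c a G : R)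
    (i0 : I) (bad : pred I) : 0 <= c -> s i0 <= a ->
  (forall i, bad i -> a + G <= s i) ->
  \sum_(i | bad i) expR (- c * s i) / (\sum_j expR (- c * s j)) <=
  #|I|%:R * expR (- (c * G)).
Proof.
move=> c0 si0 sbad; set S := \sum_j _.
(* The normalizer is at least the weight of [i0], so each bad index gets at most e^(-c (a + G)) /
   e^(-c a). *)
have S0 : expR (- c * a) <= S.
  rewrite /S (bigD1 i0)//= ler_wpDr//.
    by apply: sumr_ge0 => i _; exact: expR_ge0.
  by rewrite ler_expR !mulNr lerN2 ler_wpM2l.
have S00 : 0 < S by apply: lt_le_trans S0; exact: expR_gt0.
apply: (@le_trans _ _ (\sum_(i | bad i) expR (- (c * G)))).
  apply: ler_sum => i /sbad sai; rewrite ler_pdivrMr//.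
  apply: le_trans (ler_wpM2l (expR_ge0 _) S0).
  by rewrite -expRD ler_expR; nra.
rewrite sumr_const -[leLHS]mulr_natl.
by rewrite ler_wpM2r ?expR_ge0// ler_nat max_card.
Qed.

(** Numerator and normalizer each change by a factor at most e^e, whence the 2. *)
Lemma softmax_stable (R : realType) (I : finType) (s s' : I -> R) (e : R) (i : I) :
  (forall j, `|s j - s' j| <= e) ->
  expR (s i) / (\sum_j expR (s j)) <=
  expR (2 * e) * (expR (s' i) / (\sum_j expR (s' j))).
Proof.
move=> ss'.
have S0 (t : I -> R) : 0 < \sum_j expR (t j).
  rewrite (bigD1 i)//= ltr_pwDl ?expR_gt0//.
  by apply: sumr_ge0 => j _; exact: expR_ge0.
have le1 : expR (s i) <= expR e * expR (s' i).
  by rewrite -expRD ler_expR; have := ss' i; rewrite ler_norml; lra.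
have le2 : \sum_j expR (s' j) <= expR e * \sum_j expR (s j).
  rewrite mulr_sumr; apply: ler_sum => j _.
  by rewrite -expRD ler_expR; have := ss' j; rewrite ler_norml; lra.
rewrite ler_pdivrMr// mulrA mulrAC ler_pdivlMr// mulr_natl mulr2n expRD.
have -> : expR e * expR e * expR (s' i) * \sum_j expR (s j) =
  (expR e * expR (s' i)) * (expR e * \sum_j expR (s j)) by ring.
by apply: ler_pM => //; exact: ltW.
Qed.

(** * Maximal absolute sums over users and their concentration *)

Section yatracos_score.
Context {d : measure_display} {T : measurableType d} {R : realType}.
Variables (J : finType) (f : J -> T -> R).
Hypotheses (bf : forall j, bmeas (f j)) (f1 : forall j x, `|f j x| <= 1).

Definition max_sum n (x : n.-tuple T) : R :=
  \big[Num.max/0]_(j : J) `|\sum_u f j (tnth x u)|.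

Lemma bmeas_max_sum n : bmeas (@max_sum n).
Proof.
apply: bmeas_bigmax => j; apply: bmeas_norm; apply: bmeas_sum => u.
exact: bmeas_tnth.
Qed.

Lemma max_sum_ge n (x : n.-tuple T) j : `|\sum_u f j (tnth x u)| <= max_sum x.
Proof. by rewrite /max_sum (bigD1 j)//= le_max lexx. Qed.

Lemma max_sum_le n (x : n.-tuple T) (a : R) : 0 <= a ->
  (forall j, `|\sum_u f j (tnth x u)| <= a) -> max_sum x <= a.
Proof.
move=> a0 fa; rewrite /max_sum; elim/big_ind: _ => // y z ya za.
by rewrite ge_max ya za.
Qed.

Let max_sum_le2 n (x x' : n.-tuple T) i :
  (forall j, j != i -> tnth x j = tnth x' j) -> max_sum x <= max_sum x' + 2.
Proof.
move=> xx'; apply: max_sum_le => [|j].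
  rewrite addr_ge0// /max_sum; elim/big_ind: _ => // y z y0 z0.
  by rewrite le_max y0.
apply: le_trans (_ : `|\sum_u f j (tnth x' u)| + 2 <= _); last first.
  by rewrite lerD2r; exact: max_sum_ge.
rewrite (bigD1 i)//= [in leRHS](bigD1 i)//=.
have -> : \sum_(u < n | u != i) f j (tnth x u) = \sum_(u < n | u != i) f j (tnth x' u).
  by apply: eq_bigr => u ui; rewrite xx'.
set c := \sum_(_ < _ | _) _; have := f1 j (tnth x i); have := f1 j (tnth x' i).
rewrite !ler_norml => /andP[h1 h2] /andP[h3 h4].
have := lerNnormlW (lexx `|f j (tnth x' i) + c|).
have := ler_normlW (lexx `|f j (tnth x' i) + c|).
lra.
Qed.

Lemma max_sum_stable n (x x' : n.-tuple T) i :
  (forall j, j != i -> tnth x j = tnth x' j) -> `|max_sum x - max_sum x'| <= 2.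
Proof.
move=> xx'; have h1 := max_sum_le2 xx'.
have h2 : max_sum x' <= max_sum x + 2 by apply: (@max_sum_le2 _ _ _ i) => j /xx'.
by rewrite ler_norml; lra.
Qed.

End yatracos_score.

(** The integrand is at least 1 once the deviation exceeds t, so it stands in for the indicator of
    failure. Centring raises the bound on f to 2, hence 2 (2 l)^2 = 8 l^2 per sample and the range l
    <= 1 / 4. *)
Lemma iid_chernoff d (T : measurableType d) (R : realType) (P : probability T R)
    n (f : T -> R) (l t : R) : bmeas f -> (forall x, `|f x| <= 1) ->
  0 <= l <= 1 / 4 ->
  mean (iid P n) (fun x => expR (l * (\sum_u (f (tnth x u) - mean P f) - t)) +
                           expR (l * (- (\sum_u (f (tnth x u) - mean P f)) - t)))
  <= 2 * expR (8 * n%:R * l ^+ 2 - l * t).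
Proof.
move=> bf f1 /andP[l0 l1]; set mu := mean P f.
have mu1 : `|mu| <= 1.
  rewrite ler_norml; apply/andP; split.
    by apply: mean_ge => // x; exact: lerNnormlW.
  by apply: mean_le => // x; exact: ler_normlW.
pose g x := f x - mu.
have bg : bmeas g by apply: bmeasB => //; exact: bmeas_cst.
have g2 x : `|g x| <= 2.
  by apply: le_trans (ler_normB _ _) _; have := f1 x; lra.
have mg : mean P g = 0 by rewrite meanB ?mean_cst ?subrr//; exact: bmeas_cst.
have bS : bmeas (fun x : n.-tuple T => \sum_u g (tnth x u)).
  by apply: bmeas_sum => u; exact: bmeas_tnth.
have be k : bmeas (fun x : n.-tuple T => expR (k * \sum_u g (tnth x u))).
  by apply: bmeas_expR; exact: bmeasZ.
have tail k : `|k| = 1 -> mean (iid P n) (fun x =>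
    expR (- (l * t)) * expR (k * l * \sum_u g (tnth x u)))
    <= expR (8 * n%:R * l ^+ 2 - l * t).
  move=> k1; rewrite meanZ// [leRHS]expRD mulrC ler_wpM2r ?expR_ge0//.
  have c12 : `|k * l| * 2 <= 1 / 2 by rewrite normrM k1 mul1r ger0_norm//; lra.
  have := mgf_iid_le n bg (ler0n R 2) g2 mg c12.
  rewrite (_ : n%:R * _ = 8 * n%:R * l ^+ 2)//.
  by rewrite !exprMn -(real_normK (num_real k)) k1 expr1n; ring.
have := lerD (tail 1 (normr1 _)) (tail (-1) (normrN1 _)).
rewrite -meanD; [|exact/bmeasZ/be|exact/bmeasZ/be].
rewrite -mulr2n -[X in _ <= X -> _]mulr_natl; apply: le_trans.
rewrite le_eqVlt; apply/orP; left; apply/eqP; congr mean; apply/funext => x.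
by rewrite -!expRD; congr (expR _ + expR _); rewrite /g; ring.
Qed.

(** * Number of users sufficient for a cover *)

Section upper_bound.
Context {d : measure_display} {Z : measurableType d} {R : realType}.

(** If no set exceeded a, the supremum defining [dTV] would be at most a; choice picks one set per
    ordered pair, the empty one for close pairs. *)
Lemma separating_sets (I : Type) (q : I -> probability Z R) (a : R) :
  exists W : I * I -> set Z, (forall p, measurable (W p)) /\
    forall i j, ~ (dTV (q i) (q j) <= a%:E)%E ->
      a < `|mean (q i) (\1_(W (i, j))) - mean (q j) (\1_(W (i, j)))|.
Proof.
have /choice[W HW] (p : I * I) : exists W : set Z, measurable W /\
    (~ (dTV (q p.1) (q p.2) <= a%:E)%E ->
      a < `|mean (q p.1) (\1_W) - mean (q p.2) (\1_W)|).
  case: (pselect (dTV (q p.1) (q p.2) <= a%:E)%E) => [h|h].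
    by exists set0; split.
  have [W Wa] : exists W, measurable W /\ a < `|mean (q p.1) (\1_W) - mean (q p.2) (\1_W)|.
    apply: contrapT => H; apply: h; apply/dTV_leP => W mW.
    by rewrite leNgt; apply/negP => aW; apply: H; exists W.
  by exists W; case: Wa => mW aW; split.
exists W; split=> [p|i j]; first by case: (HW p).
by case: (HW (i, j)).
Qed.

Lemma dlearn_upper (PP : set (probability Z R)) N (q : 'I_N.+1 -> probability Z R)
    (m n : nat) (alpha eps B : R) :
  (0 < m)%N -> 0 < alpha -> 0 < eps -> alpha <= B -> small_bias alpha B m ->
  (forall D, PP D -> exists i, (dTV (q i) D <= (alpha / 10)%:E)%E) ->
  N.+1%:R ^+ 3 * (2 * expR (- (n%:R * (alpha / B) ^+ 2 / 128 / 100))) <= 1 / 6 ->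
  N.+1%:R * expR (- (eps * n%:R * (alpha / B) / 40)) <= 1 / 6 ->
  exists A : R.-pker (n.-tuple (m.-tuple Z)) ~> learned Z R,
    user_level_DP eps 0 A /\ solves (dlearn PP alpha) A.
Proof.
move=> m0 alpha0 eps0 alphaB bias cov cond1 cond2.
have B0 : 0 < B by lra.
(* A member outside the alpha-ball around D is farther than 9 / 10 alpha from one within alpha / 10
   of D. *)
have [W [mW Wsep]] := separating_sets q (9 / 10 * alpha).
pose f i p : m.-tuple Z -> R := @user_stat _ _ _ (W p) (mean (q i) (\1_(W p))) B m.
have bf i p : bmeas (f i p) by exact: bmeas_user_stat.
have f1 i p x : `|f i p x| <= 1 by exact: clip_norm.
pose s i (x : n.-tuple (m.-tuple Z)) := max_sum (f i) x.
have bs i : bmeas (s i) by exact: bmeas_max_sum.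
(* Scores move by at most 2 per user, and [softmax_stable] doubles the exponent c 2, which gives
   eps. *)
pose c := eps / 4.
have c0 : 0 <= c by rewrite /c; lra.
pose S x := \sum_i expR (- c * s i x).
pose w i x := expR (- c * s i x) / S x.
have S0 x : 0 < S x.
  rewrite /S (bigD1 ord0)//= ltr_pwDl ?expR_gt0//.
  by apply: sumr_ge0 => j _; exact: expR_ge0.
have be i : bmeas (fun x => expR (- c * s i x)) by apply: bmeas_expR; exact: bmeasZ.
have bw i : bmeas (w i).
  (* A bounded score keeps the normalizer above a positive constant, so its inverse is bounded. *)
  have [_ [M sM]] := bs ord0.
  apply: bmeasM => //; apply: (@bmeasV _ _ _ (expR (- c * M))); first exact: expR_gt0.
    move=> x; rewrite /S (bigD1 ord0)//= ler_wpDr//.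
      by apply: sumr_ge0 => j _; exact: expR_ge0.
    by rewrite ler_expR !mulNr lerN2 ler_wpM2l//; exact: ler_normlW.
  exact: bmeas_sum.
have w0 i x : 0 <= w i x by rewrite divr_ge0 ?expR_ge0// ltW.
have w1 x : \sum_i w i x = 1 by rewrite /w -mulr_suml -/(S x) divff// gt_eqF.
have [A AE] := @finite_mixture_kernel _ _ _ (learned Z R) _ _ w q w0 w1 bw.
exists A; split.
  move=> x x' [u xx'] E mE; rewrite !AE adde0 -EFinM lee_fin mulr_sumr.
  apply: ler_sum => i _; rewrite mulrA ler_wpM2r// /w.
  have -> : eps = 2 * (c * 2) by rewrite /c; field.
  apply: (@softmax_stable _ _ (fun i => - c * s i x) (fun i => - c * s i x')) => j.
  rewrite -mulrBr normrM normrN (ger0_norm c0) ler_wpM2l//.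
  exact: max_sum_stable xx'.
move=> D PPD; have [i0 qi0] := cov D PPD.
pose ball : set (learned Z R) := TV_ball D alpha.
pose bad i := ~~ `[< ball (q i) >].
pose mu i p := mean (iid D m) (f i p).
set ga := alpha / B in cond1 cond2 *.
have ga0 : 0 < ga by exact: divr_gt0.
have ga1 : ga <= 1 by rewrite ler_pdivrMr// mul1r.
have near p : `|mu i0 p| <= ga / 5.
  apply: mean_user_stat_near => //.
  by have /dTV_leP := qi0; move=> /(_ _ (mW p)); rewrite distrC.
(* On the set separating [i0] from i, replacing the i0-th member by D costs alpha / 10 and leaves 4
   / 5 alpha. *)
have far i : bad i -> 2 / 5 * ga <= `|mu i (i0, i)|.
  move=> badi; apply: mean_user_stat_far => //.
  have /Wsep : ~ (dTV (q i0) (q i) <= (9 / 10 * alpha)%:E)%E.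
    move=> h; move/negP: badi; apply; apply/asboolP.
    by apply: le_trans (dTV_triangle h qi0) _; rewrite lee_fin; lra.
  have /dTV_leP /(_ _ (mW (i0, i))) := qi0.
  set x := mean (q i0) _; set y := mean D _; set z := mean (q i) _.
  move=> xy xz; have := ler_distD y x z; lra.
(* Then l = t / (16 n) minimizes 8 n l^2 - l t, with value - n ga^2 / 12800. *)
pose t := n%:R * (ga / 20).
pose l := ga / 320.
pose Y i p (x : n.-tuple (m.-tuple Z)) := \sum_u (f i p (tnth x u) - mu i p).
have YE i p x : Y i p x = \sum_u f i p (tnth x u) - n%:R * mu i p.
  by rewrite /Y sumrB sumr_const card_ord mulr_natl.
pose e i p x := expR (l * (Y i p x - t)) + expR (l * (- Y i p x - t)).
have be' i p : bmeas (e i p).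
  have bY : bmeas (Y i p).
    apply: bmeas_sum => u; apply: bmeasB; last exact: bmeas_cst.
    exact: bmeas_tnth.
  apply: bmeasD; apply/bmeas_expR/bmeasZ; apply: bmeasB; do ?exact: bmeas_cst => //.
    exact: bY.
  exact: bmeasN.
have e0 i p x : 0 <= e i p x by rewrite addr_ge0 ?expR_ge0.
have es0 x : 0 <= \sum_i \sum_p e i p x.
  by apply: sumr_ge0 => i _; apply: sumr_ge0.
(* Either some deviation exceeds t and the exponentials already exceed 1, or the score of [i0] is at
   most n ga (1 / 5 + 1 / 20) and bad scores are at least n ga (2 / 5 - 1 / 20): a gap of n ga /
   10. *)
have pw x : \sum_(i | bad i) w i x <=
    \sum_i \sum_p e i p x + N.+1%:R * expR (- (eps * n%:R * ga / 40)).
  case: (pselect (exists i p, t < `|Y i p x|)) => [[i [p tY]]|H].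
    apply: (@le_trans _ _ 1).
      by rewrite -(w1 x) [leRHS](bigID bad)/= lerDl sumr_ge0.
    rewrite ler_wpDr ?mulr_ge0 ?expR_ge0//.
    rewrite (bigD1 i)//= ler_wpDr//; first by do 2 (apply: sumr_ge0 => ? _).
    rewrite (bigD1 p)//= ler_wpDr//; first by apply: sumr_ge0.
    have l0 : 0 <= l by rewrite /l; lra.
    have [Y0|Y0] := leP 0 (Y i p x).
      rewrite (ger0_norm Y0) in tY; rewrite /e ler_wpDr ?expR_ge0//.
      by rewrite -[leLHS]expR0 ler_expR mulr_ge0//; lra.
    rewrite (ltr0_norm Y0) in tY; rewrite /e ler_wpDl ?expR_ge0//.
    by rewrite -[leLHS]expR0 ler_expR mulr_ge0//; lra.
  apply: le_trans (_ : N.+1%:R * expR (- (eps * n%:R * ga / 40)) <= _); last first.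
    by rewrite lerDr.
  have {}H i p : `|Y i p x| <= t by rewrite leNgt; apply/negP => h; apply: H; exists i, p.
  have ng0 : 0 <= n%:R * ga by rewrite mulr_ge0// ltW.
  have -> : eps * n%:R * ga / 40 = c * (n%:R * ga / 10) by rewrite /c; field.
  have := @softmax_bad_mass R 'I_N.+1 (s ^~ x) c (n%:R * ga / 4) (n%:R * ga / 10) i0 bad c0.
  rewrite card_ord; apply.
    apply: max_sum_le => [|p]; first by lra.
    have := H i0 p; rewrite YE => HY.
    have : `|n%:R * mu i0 p| <= n%:R * (ga / 5).
      by rewrite normrM ger0_norm// ler_wpM2l.
    set a := \sum_u _ in HY *; set b := n%:R * mu i0 p in HY *.
    have := ler_distD b a 0; rewrite !subr0 /t in HY *; lra.
  move=> i badi; apply: le_trans (max_sum_ge _ _ (i0, i)).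
  have := H i (i0, i); rewrite YE => HY.
  have : n%:R * (2 / 5 * ga) <= `|n%:R * mu i (i0, i)|.
    by rewrite normrM (ger0_norm (ler0n _ _)) ler_wpM2l// far.
  set a := \sum_u _ in HY *; set b := n%:R * mu i (i0, i) in HY *.
  have := ler_distD a b 0; rewrite !subr0 distrC /t in HY *; lra.
have Eint : (\int[iid (iid D m) n]_x A x ball)%E =
    (mean (iid (iid D m) n) (fun x => 1 - \sum_(i | bad i) w i x))%:E.
  rewrite meanE; last by apply: bmeasB; [exact: bmeas_cst|exact: bmeas_sum].
  apply: eq_integral => x _; rewrite AE; congr EFin.
  rewrite -(w1 x) [X in _ = X - _](bigID bad)/= [RHS]addrAC subrr add0r [RHS]big_mkcond/=.
  apply: eq_bigr => i _; rewrite indicE /bad; case: asboolP => h /=.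
    by rewrite mem_set// mulr1.
  by rewrite memNset// mulr0.
rewrite Eint lee_fin meanB; [|exact: bmeas_cst|exact: bmeas_sum].
rewrite mean_cst.
have bes : bmeas (fun x => \sum_i \sum_p e i p x).
  by apply: bmeas_sum => i; exact: bmeas_sum.
have : mean (iid (iid D m) n) (fun x => \sum_(i | bad i) w i x) <=
    mean (iid (iid D m) n) (fun x => \sum_i \sum_p e i p x) +
    N.+1%:R * expR (- (eps * n%:R * ga / 40)).
  rewrite -[X in _ + X](mean_cst (iid (iid D m) n)) -meanD//; last exact: bmeas_cst.
  apply: le_mean => //; first exact: bmeas_sum.
  by apply: bmeasD => //; exact: bmeas_cst.
(* Union bound over all members and all ordered pairs, whence the cube. With the softmax term, also
   at most 1 / 6, the success probability is at least 2 / 3. *)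
have : mean (iid (iid D m) n) (fun x => \sum_i \sum_p e i p x) <= 1 / 6.
  apply: le_trans cond1; rewrite mean_sum; last by move=> i; exact: bmeas_sum.
  rewrite (_ : N.+1%:R ^+ 3 * _ = \sum_(i < N.+1) \sum_(p : 'I_N.+1 * 'I_N.+1)
      2 * expR (- (n%:R * ga ^+ 2 / 128 / 100))); last first.
    rewrite !sumr_const card_prod !card_ord -!mulrnA -[RHS]mulr_natl.
    rewrite !natrM; ring.
  apply: ler_sum => i _; rewrite mean_sum//; apply: ler_sum => p _.
  have -> : - (n%:R * ga ^+ 2 / 128 / 100) = 8 * n%:R * l ^+ 2 - l * t.
    by rewrite /l /t; field.
  apply: iid_chernoff => //; rewrite /l; lra.
lra.
Qed.

End upper_bound.

(** * Numerical choice of the parameters *)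

Lemma ln_nat_ge_half (R : realType) (N : nat) : (1 < N)%N -> 1 / 2 <= ln (N%:R : R).
Proof.
move=> N1; have N2 : 2 <= N%:R :> R by rewrite ler_nat.
rewrite -[leLHS]expRK ler_ln ?posrE ?expR_gt0//; last lra.
exact: le_trans (expR_half_le2 R) N2.
Qed.

(** Here e^-x <= N^-(j + k), and the surplus N^-k is at most 2^-k. *)
Lemma expR_ln_tail (R : realType) (N : nat) (x : R) (j k : nat) : (1 < N)%N ->
  (j + k)%:R * ln N%:R <= x -> N%:R ^+ j * expR (- x) <= (1 / 2) ^+ k.
Proof.
move=> N1 xN; have N2 : 2 <= N%:R :> R by rewrite ler_nat.
have N0 : 0 < N%:R :> R by lra.
apply: (@le_trans _ _ (N%:R ^+ j * (N%:R ^+ (j + k))^-1)).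
  have -> : (N%:R ^+ (j + k))^-1 = expR (- ((j + k)%:R * ln N%:R)) :> R.
    by rewrite expRN expRM_natl lnK ?posrE.
  by rewrite ler_wpM2l ?exprn_ge0// ler_expR lerN2.
rewrite exprD invfM mulVKf ?expf_neq0 ?gt_eqF// -exprVn.
by rewrite lerXn2r ?nnegrE ?invr_ge0 ?(ltW N0)// ?divr_ge0// div1r lef_pV2 ?posrE.
Qed.

Section parameters.
Context {R : realType}.

Lemma sample_size_const (G U V : R) : 1 <= G -> 0 <= U ->
  U <= 1568 * G -> V <= 28 * G ->
  1 + (9 * 10 ^+ 4 * U + 160 * V) <= 10 ^+ 9 * G.
Proof.
move=> G1 U0 UG VG.
apply: (@le_trans _ _ (10 ^+ 5 * (10 ^+ 4 * G))); last first.
  by rewrite mulrA -exprD.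
apply: (@le_trans _ _ (10 ^+ 5 * (1568 * G) + 160 * (28 * G) + G)).
  have : 9 * 10 ^+ 4 * U <= 10 ^+ 5 * U by apply: ler_wpM2r => //; lra.
  have : 10 ^+ 5 * U <= 10 ^+ 5 * (1568 * G) by apply: ler_wpM2l.
  lra.
have : 10 ^+ 5 * (1569 * G) <= 10 ^+ 5 * (10 ^+ 4 * G).
  by apply: ler_wpM2l => //; apply: ler_wpM2r; lra.
lra.
Qed.

(* B is alpha plus the standard deviation 1 / sqrt m of a user's empirical
   frequency, inflated by the logarithm that makes the clipping bias small. *)
Definition clip_radius (alpha : R) (m : nat) : R :=
  alpha + 4 * ln (1 + 80 / (alpha * Num.sqrt m%:R)) / Num.sqrt m%:R.

Lemma clip_radius_ge (alpha : R) (m : nat) : (0 < m)%N -> 0 < alpha ->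
  alpha <= clip_radius alpha m.
Proof.
move=> m0 a0; have s0 : 0 < Num.sqrt m%:R :> R by rewrite sqrtr_gt0 ltr0n.
rewrite lerDl mulr_ge0 ?invr_ge0 ?(ltW s0)// mulr_ge0// ln_ge0// lerDl.
by rewrite divr_ge0// ltW// mulr_gt0.
Qed.

(** With s = sqrt m and x = 80 / (alpha s), the logarithm in the radius gives e^(- B s / 4) <= 1 /
    (1 + x) <= 1 / x, and 8 / (B s x) is exactly alpha / (10 B). *)
Lemma clip_radius_small_bias (alpha : R) (m : nat) : (0 < m)%N -> 0 < alpha ->
  small_bias alpha (clip_radius alpha m) m.
Proof.
move=> m0 a0; have aB := clip_radius_ge m0 a0.
rewrite /small_bias; set B := clip_radius alpha m in aB *.
set s := Num.sqrt m%:R; have s0 : 0 < s by rewrite sqrtr_gt0 ltr0n.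
have B0 : 0 < B by lra.
set x := 80 / (alpha * s).
have x0 : 0 < x by rewrite divr_gt0// mulr_gt0.
have eB : expR (- (B * s / 4)) <= x^-1.
  apply: (@le_trans _ _ (1 + x)^-1); last by rewrite lef_pV2 ?posrE; lra.
  rewrite -(@lnK _ (1 + x)) ?posrE; last lra.
  rewrite -expRN ler_expR lerN2.
  have -> : B * s / 4 = alpha * s / 4 + ln (1 + x).
    by rewrite /B /clip_radius -/s -/x; field; rewrite gt_eqF.
  by rewrite lerDr; apply: divr_ge0 => //; apply: mulr_ge0; exact: ltW.
apply: (@le_trans _ _ (8 / (B * s) * x^-1)).
  by rewrite ler_wpM2l// divr_ge0// mulr_ge0// ltW.
rewrite le_eqVlt; apply/orP; left; apply/eqP; rewrite /x; field.
by rewrite !gt_eqF.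
Qed.

(** In terms of t = 1 / (alpha sqrt m), g is L / eps (1 + t) + L t^2 and u is 1 + t up to a
    logarithm. The square of u brings in two logarithmic factors, whence the exponent 2. *)
Lemma sample_size_le (L alpha eps g u : R) (m : nat) :
  (0 < m)%N -> 0 < alpha -> 0 < eps <= 1 / 2 -> 1 / 2 <= L ->
  g = L / eps + L / (alpha * eps * Num.sqrt m%:R) + L / (alpha ^+ 2 * m%:R) ->
  u = clip_radius alpha m / alpha ->
  1 + ((9 * 10 ^+ 4) * (L * u ^+ 2) + 160 * (L / eps * u)) <= 10 ^+ 9 * (g * polylog 2 g).
Proof.
move=> m0 a0 /andP[e0 e1] L1 gdef udef.
have s0 : 0 < Num.sqrt m%:R :> R by rewrite sqrtr_gt0 ltr0n.
have ss : Num.sqrt m%:R ^+ 2 = m%:R :> R by rewrite sqr_sqrtr.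
set s := Num.sqrt m%:R in s0 ss.
pose t := (alpha * s)^-1.
have t0 : 0 < t by rewrite invr_gt0 mulr_gt0.
pose Le := L / eps.
(* The bounds L >= 1 / 2 and eps <= 1 / 2 yield g >= 1, which absorbs the rounding term 1. *)
have Le1 : 1 <= Le by rewrite ler_pdivlMr//; lra.
have LLe : L <= Le by rewrite ler_pdivlMr// ler_piMr//; lra.
have gE : g = Le + Le * t + L * t ^+ 2.
  by rewrite gdef /Le /t -/s -ss; field; rewrite !gt_eqF.
have Le0 : 0 <= Le by lra.
have Let0 : 0 <= Le * t by apply: mulr_ge0; lra.
have Ltt0 : 0 <= L * t ^+ 2 by apply: mulr_ge0; [lra|rewrite sqr_ge0].
have g1 : 1 <= g by lra.
have tg : t <= g.
  have : 1 * t <= Le * t by rewrite ler_wpM2r// ltW.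
  lra.
pose P := 1 + ln (1 + g).
have lg0 : 0 <= ln (1 + g) by rewrite ln_ge0//; lra.
have P1 : 1 <= P by rewrite lerDl.
have P0 : 0 <= P by lra.
have ln2 : ln 2 <= 1 :> R.
  by rewrite (_ : 2 = 1 + 1)//; apply: le_ln1Dx; lra.
(* The 7 comes from 80 <= 2^7 and ln 2 <= 1. *)
have lnt : ln (1 + 80 * t) <= 7 * P.
  apply: (@le_trans _ _ (ln (2 ^+ 7 * (1 + g)))).
    by rewrite ler_ln ?posrE; [rewrite -natrX; lra|lra|rewrite mulr_gt0 ?exprn_gt0//; lra].
  rewrite lnM ?posrE ?exprn_gt0//; last lra.
  rewrite lnXn// -[ln 2 *+ 7]mulr_natl /P; lra.
have lnt0 : 0 <= ln (1 + 80 * t) by rewrite ln_ge0//; lra.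
have uE : u = 1 + 4 * ln (1 + 80 * t) * t.
  rewrite udef /clip_radius -/s -/t mulrDl divff ?gt_eqF//; congr (_ + _).
  by rewrite -mulrA -invfM [s * _]mulrC.
have u0 : 0 <= u by rewrite uE addr_ge0// mulr_ge0 ?(ltW t0)// mulr_ge0.
have ule : u <= 28 * P * (1 + t).
  have : ln (1 + 80 * t) * t <= 7 * P * t by rewrite ler_wpM2r// ltW.
  rewrite uE; lra.
(* By (1 + t)^2 <= 2 (1 + t^2), with 1568 = 2 times 28^2. *)
have u2le : u ^+ 2 <= 1568 * P ^+ 2 * (1 + t ^+ 2).
  apply: (@le_trans _ _ ((28 * P * (1 + t)) ^+ 2)).
    by rewrite lerXn2r ?nnegrE// mulr_ge0//; lra.
  have : 0 <= (P * (1 - t)) ^+ 2 by rewrite sqr_ge0.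
  rewrite !exprMn; lra.
have PP : P <= P ^+ 2 by rewrite -[leLHS]mulr1 ler_wpM2l//; lra.
have h1 : L * u ^+ 2 <= 1568 * (g * P ^+ 2).
  apply: (@le_trans _ _ (L * (1568 * P ^+ 2 * (1 + t ^+ 2)))).
    by rewrite ler_wpM2l//; lra.
  have : (L + L * t ^+ 2) * P ^+ 2 <= g * P ^+ 2.
    by rewrite ler_wpM2r ?sqr_ge0// gE; lra.
  lra.
have h2 : Le * u <= 28 * (g * P ^+ 2).
  apply: (@le_trans _ _ (Le * (28 * P * (1 + t)))).
    by rewrite ler_wpM2l//; lra.
  have : (Le + Le * t) * P <= g * P ^+ 2.
    apply: ler_pM => //; first exact: addr_ge0.
    by rewrite gE lerDl.
  lra.
have h3 : 1 <= g * P ^+ 2.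
  by rewrite -[leLHS]mulr1 ler_pM//; lra.
rewrite -/Le /polylog -/P.
apply: sample_size_const => //.
by apply: mulr_ge0; [lra|exact: sqr_ge0].
Qed.

End parameters.

(** * Both bounds with explicit constants *)

Theorem theoremE7 (R : realType) :
  exists (c0 C : R) (k : nat), [/\ 0 < c0, 0 < C &
  forall (d : measure_display) (Z : measurableType d)
    (PP : set (probability Z R)) (m : nat) (alpha beta eps : R),
    (0 < m)%N ->
    0 < alpha <= c0 -> 0 < beta <= c0 -> 0 < eps <= c0 ->
    (forall L : R,
       (exists QQ : set (probability Z R),
          has_size QQ L /\ is_cover (@dTV d Z R) (alpha / 10) PP QQ) ->
       let g := L / eps + L / (alpha * eps * Num.sqrt m%:R)
                + L / (alpha ^+ 2 * m%:R) in
       (user_complexity m (dlearn PP alpha) eps 0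
          <= (C * (g * polylog k g))%:E)%E)
    /\
    (forall L : R,
       (exists QQ : set (probability Z R),
          [/\ has_size QQ L,
              is_packing (@dTV d Z R) (3 * alpha) PP QQ &
              (diameter (@dKL d Z R) QQ <= beta%:E)%E]) ->
       let g := L / eps + L / (eps * Num.sqrt (m%:R * beta))
                + L / (m%:R * beta) in
       ((C^-1 * (g / polylog k g))%:E
          <= user_complexity m (dlearn PP alpha) eps 0)%E)].
Proof.
(* The range 1 / 2 is the one for eps in [dlearn_lower] and [sample_size_le]; the constant of the
   latter also exceeds the 18 of the former. *)
exists (1 / 2), (10 ^+ 9), 2%N; split; [lra|by rewrite exprn_gt0|].
move=> d Z PP m alpha beta eps m0 /andP[a0 a1] /andP[b0 b1] e01.
have /andP[e0 e1] := e01; split=> [L [QQ [sizeL cov]]|L [QQ [sizeL pack diam]]];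
  lazy zeta; set g := L / eps + _ + _.
- have [N [q [N0 LE _ _ qQ]]] := has_size_enum sizeL.
  have covq D : PP D -> exists i, (dTV (q i) D <= (alpha / 10)%:E)%E.
    by move=> /cov[Q /qQ[i <-] h]; exists i.
  case: N q N0 LE qQ covq => // N q _ LE _ covq.
  case: N q LE covq => [|N] q LE covq.
    (* A one-element cover has L = 0, so the bound is 0 and no user may be asked: the algorithm
       always outputs that element. *)
    apply: ge_ereal_inf; exists 0%:E; last first.
      by rewrite /g LE ln1 !mul0r !addr0 mul0r mulr0.
    have [A AE] := @finite_mixture_kernel _ _ (0.-tuple (m.-tuple Z))
      (learned Z R) R 0 (fun _ _ => 1) q (fun _ _ => ler01)
      (fun _ => big_ord1 _ _) (fun _ => bmeas_cst 1).
    exists 0%N => //; exists A; split; first by move=> x x' [[]].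
    move=> D PPD; have [i qi] := covq D PPD.
    apply: (@le_trans _ _ (mean (iid (iid D m) 0) (fun=> 1))%:E).
      by rewrite mean_cst lee_fin; lra.
    rewrite meanE; last exact: bmeas_cst.
    rewrite le_eqVlt; apply/orP; left; apply/eqP; apply: eq_integral => x _.
    rewrite AE big_ord1 mul1r indicE mem_set//= -[ord0](ord1 i).
    by apply: le_trans qi _; rewrite lee_fin; lra.
  have L1 : 1 / 2 <= L by rewrite LE ln_nat_ge_half.
  pose B := clip_radius alpha m.
  have aB : alpha <= B by exact: clip_radius_ge.
  have B0 : 0 < B by lra.
  (* Tail exponents 3 + 4 ask for n (alpha / B)^2 >= 7 times 12800 L, and 1 + 3 for eps n alpha / B
     >= 4 times 40 L. The failure terms become 2 / 2^4 and 1 / 2^3, both below 1 / 6. *)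
  pose X := (9 * 10 ^+ 4) * (L * (B / alpha) ^+ 2) + 160 * (L / eps * (B / alpha)).
  have X1 : 0 <= (9 * 10 ^+ 4) * (L * (B / alpha) ^+ 2).
    apply: mulr_ge0; [by rewrite mulr_ge0 ?exprn_ge0|].
    by apply: mulr_ge0; [lra|rewrite sqr_ge0].
  have X2 : 0 <= 160 * (L / eps * (B / alpha)).
    apply: mulr_ge0 => //; apply: mulr_ge0; apply: divr_ge0 => //; lra.
  have X0 : 0 <= X by exact: addr_ge0.
  pose n := (Num.truncn X).+1.
  have /andP[nX Xn] := truncn_itv X0.
  have Xn' : X <= n%:R by rewrite ltW.
  have ga0 : 0 < alpha / B by rewrite divr_gt0.
  have gaE : (B / alpha) * (alpha / B) = 1 by field; rewrite !gt_eqF.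
  have [A [DP sol]] : exists A : R.-pker (n.-tuple (m.-tuple Z)) ~> learned Z R,
      user_level_DP eps 0 A /\ solves (dlearn PP alpha) A.
    apply: (@dlearn_upper _ _ _ PP N.+1 q m n alpha eps B) => //.
    - exact: clip_radius_small_bias.
    - rewrite mulrCA.
      have : N.+2%:R ^+ 3 * expR (- (n%:R * (alpha / B) ^+ 2 / 128 / 100)) <=
          (1 / 2 : R) ^+ 4.
        apply: (@expR_ln_tail R N.+2 _ 3 4 isT); rewrite -LE !ler_pdivlMr//.
        have : 9 * 10 ^+ 4 * (L * (B / alpha) ^+ 2) * (alpha / B) ^+ 2 <=
            n%:R * (alpha / B) ^+ 2.
          by rewrite ler_wpM2r ?sqr_ge0//; apply: le_trans Xn'; rewrite lerDl.
        have -> : 9 * 10 ^+ 4 * (L * (B / alpha) ^+ 2) * (alpha / B) ^+ 2 =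
            9 * 10 ^+ 4 * L.
          by rewrite -mulrA -(mulrA L) -exprMn gaE expr1n mulr1.
        rewrite -[(3 + 4)%N]/7%N; lra.
      lra.
    - rewrite -[N.+2%:R]expr1.
      have : N.+2%:R ^+ 1 * expR (- (eps * n%:R * (alpha / B) / 40)) <= (1 / 2 : R) ^+ 3.
        apply: (@expR_ln_tail R N.+2 _ 1 3 isT); rewrite -LE ler_pdivlMr//.
        have : 160 * (L / eps * (B / alpha)) * (eps * (alpha / B)) <=
            n%:R * (eps * (alpha / B)).
          apply: ler_wpM2r; first by apply: mulr_ge0; exact: ltW.
          by apply: le_trans Xn'; rewrite lerDr.
        have -> : 160 * (L / eps * (B / alpha)) * (eps * (alpha / B)) = 160 * L.
          by field; rewrite !gt_eqF.
        rewrite -[(1 + 3)%N]/4%N; lra.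
      lra.
  apply: ge_ereal_inf; exists (n%:R%:E); first by exists n => //; exists A.
  rewrite lee_fin; apply: le_trans (sample_size_le m0 a0 e01 L1 erefl erefl).
  by rewrite -/B -/X /n -natr1; lra.
- have L0 : 0 <= L by have [N [N0 _ ->]] := sizeL; rewrite ln_ge0// ler1n.
  have g0 : 0 <= g.
    rewrite !addr_ge0// divr_ge0// ?mulr_ge0 ?sqrtr_ge0//; exact: ltW.
  have P1 : 1 <= polylog 2 g by rewrite exprn_ege1// lerDl ln_ge0// lerDl.
  (* Each feasible n satisfies g <= 18 n; dividing by [polylog], which is at least 1, only lowers
     the left-hand side. *)
  apply: le_ereal_inf_tmp => _ [n [A [DP sol]] <-]; rewrite lee_fin.
  have gn : g <= 18 * n%:R by exact: (dlearn_lower m0 a0 b0 e01 sizeL pack diam DP sol).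
  rewrite ler_pdivrMl ?exprn_gt0// ler_pdivrMr; last lra.
  apply: (le_trans gn); rewrite -[leLHS]mulr1 ler_pM ?mulr_ge0// ler_wpM2r//.
  by apply: (@le_trans _ _ (10 ^+ 2)); [lra|rewrite ler_weXn2l//; lra].
Qed.
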